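(* For a Fréchet locally convex space $E$ the following conditions are equivalent: (i) $E$ contains no isomorphic copy of $\ell_1$; (ii) each closed and convex bounded subset of $E$ is an Ascoli space in the (relative) weak topology of $E$.
   Context: A Fréchet locally convex space is a metrizable and complete locally convex space. An isomorphic copy of $\ell_1$ in $E$ is a linear subspace of $E$ linearly homeomorphic to $\ell_1$. For a topological space $Z$, $C_k(Z)$ denotes the space of all continuous functions $Z\to\mathbb{R}$ endowed with the compact-open topology. A subset $\mathcal{K}\subset C_k(Z)$ is evenly continuous if the evaluation map $(z,f)\mapsto f(z)$ restricted to $Z\times\mathcal{K}$ is jointly continuous, i.e. for every $z\in Z$, every $f\in\mathcal{K}$ and every neighborhood $O$ of $f(z)$ in $\mathbb{R}$ there are neighborhoods $U_f\subset\mathcal{K}$ of $f$ (in $\mathcal{K}$) and $O_z\subset Z$ of $z$ such that $g(y)\in O$ for all $g\in U_f$, $y\in O_z$. A Tychonoff space $Z$ is called an Ascoli space if every compact subset of $C_k(Z)$ is evenly continuous. *)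

(* Defs.v *)
From HB Require Import structures.
From mathcomp Require Import all_boot all_order all_algebra.
From mathcomp Require Import all_classical all_reals all_analysis.

Set Implicit Arguments.
Unset Strict Implicit.
Unset Printing Implicit Defensive.

Import Order.TTheory GRing.Theory Num.Theory.
Import numFieldNormedType.Exports.

Local Open Scope classical_set_scope.
Local Open Scope ring_scope.

(* A real locally convex space is a [tvsType R] with [R : realType].  The class
   only asks its uniform structure to be compatible with the topology, so
   completeness is stated below for the translation-invariant uniformity. *)

Section Frechet.
Context {R : realType}.

Definition metrizable (T : topologicalType) := exists d : T -> T -> R,
  [/\ forall x y, 0 <= d x y, forall x y, d x y = 0 <-> x = y,
      forall x y, d x y = d y x, forall x y z, d x z <= d x y + d y z
    & forall x, nbhs x = filter_from [set e | 0 < e]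
                           (fun e => [set y | d x y < e])].

Definition tvs_cauchy (E : tvsType R) (F : set_system E) :=
  (fun xy : E * E => xy.1 - xy.2) @ (F, F) --> (0 : E).

Definition tvs_complete (E : tvsType R) := forall F : set_system E,
  ProperFilter F -> tvs_cauchy F -> exists x : E, F --> x.

Definition frechet (E : tvsType R) := metrizable E /\ tvs_complete E.

Definition tvs_bounded (E : tvsType R) (A : set E) :=
  forall U : set E, nbhs 0 U ->
    \forall t \near +oo%R, A `<=` [set t *: u | u in U].

End Frechet.

Section Weak.
Context {R : realType}.

Definition dual (E : tvsType R) :=
  {f : {linear E -> R^o} | continuous (f : E -> R^o)}.

Definition weak_space (E : tvsType R) : Type := E.

HB.instance Definition _ (E : tvsType R) := Topological.copy (weak_space E)
  (sup_topology (fun f : dual E =>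
    Topological.class (initial_topology (sval f : E -> R^o)))).

End Weak.

Section Ascoli.
Context {R : realType}.

Definition C_k (Z : topologicalType) : Type := continuousType Z R.

HB.instance Definition _ (Z : topologicalType) := Topological.copy (C_k Z)
  (initial_topology (fun f : continuousType Z R =>
    (f : Z -> R) : {compact-open, Z -> R})).

(* A set used as a type is the subtype with the relative topology, so this is
   the joint continuity of the evaluation map on Z x K. *)
Definition evenly_continuous (Z : topologicalType) (K : set (C_k Z)) :=
  continuous (fun zf : Z * K => (set_val zf.2 : continuousType Z R) zf.1).

(* By [uniform_separatorP], [completely_regular_space] is the separation of
   points from closed sets by continuous real-valued functions. *)
Definition tychonoff_space (Z : topologicalType) :=
  hausdorff_space Z /\ completely_regular_space Z.

Definition ascoli_space (Z : topologicalType) :=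
  tychonoff_space Z /\
  forall K : set (C_k Z), compact K -> evenly_continuous K.

End Ascoli.
Arguments C_k : clear implicits.
Arguments ascoli_space : clear implicits.

Section ell1.
Context {R : realType}.

Definition ell1_pred : {pred R^nat} :=
  mem [set u : R^nat | cvgn (series (fun n => `|u n|))].

Lemma ell1_submod_closed : submod_closed ell1_pred.
Proof.
split.
  rewrite inE /= (_ : series _ = cst 0); first exact: is_cvg_cst.
  by apply/funext => n; rewrite /series /= big1// => i _; rewrite normr0.
move=> a u v; rewrite !inE /= => cu cv.
apply: (series_le_cvg (v_ := fun n => `|a| * `|u n| + `|v n|)) => //.
  by move=> n /=; rewrite -normrM; exact: ler_normD.
have -> : series (fun n => `|a| * `|u n| + `|v n|) =
          (fun n => `|a| * series (fun n => `|u n|) n +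
                    series (fun n => `|v n|) n).
  by apply/funext => n; rewrite /series /= big_split/= mulr_sumr.
by apply: is_cvgD => //; apply: is_cvgMr.
Qed.

HB.instance Definition _ := GRing.isSubmodClosed.Build R (R^nat) ell1_pred
  ell1_submod_closed.

Record ell1 := Ell1 { ell1_seq :> nat -> R ; _ : ell1_seq \in ell1_pred }.

HB.instance Definition _ := [isSub for ell1_seq].
HB.instance Definition _ := [Choice of ell1 by <:].
HB.instance Definition _ := [SubChoice_isSubLmodule of ell1 by <:].

Definition ell1_norm (u : ell1) : R := limn (series (fun n => `|u n|)).

Lemma ell1_cvg (u : ell1) : cvgn (series (fun n => `|u n|)).
Proof. by case: u => u /=; rewrite inE. Qed.

Lemma ell1_normD (u v : ell1) : ell1_norm (u + v) <= ell1_norm u + ell1_norm v.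
Proof.
rewrite /ell1_norm -limD; [|exact: ell1_cvg..].
apply: ler_lim; first exact: ell1_cvg.
  by apply: is_cvgD; exact: ell1_cvg.
apply: nearW => n.
have -> : (series (fun n => `|u n|) + series (fun n => `|v n|)) n =
    \sum_(0 <= i < n) (`|u i| + `|v i|) by rewrite big_split.
by apply: ler_sum => i _; exact: ler_normD.
Qed.

Lemma ell1_normZ (a : R) (u : ell1) : ell1_norm (a *: u) = `|a| * ell1_norm u.
Proof.
apply: cvg_lim => //.
rewrite (_ : series _ = fun n => `|a| * series (fun n => `|u n|) n).
  by apply: cvgMr; exact: ell1_cvg.
apply/funext => n; rewrite /series /= mulr_sumr.
by apply: eq_bigr => i _; exact: normrM.
Qed.

Lemma ell1_norm_eq0 (u : ell1) : ell1_norm u = 0 -> u = 0.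
Proof.
move=> u0; apply/val_inj/funext => n /=; apply/normr0_eq0/eqP.
rewrite eq_le normr_ge0 andbT.
have ndu : nondecreasing_seq (series (fun n => `|u n|)).
  by apply: nondecreasing_series => i _ _; exact: normr_ge0.
have := nondecreasing_cvgn_le ndu (@ell1_cvg u) n.+1.
rewrite -/(ell1_norm u) u0; apply: le_trans.
by rewrite /series/= big_nat_recr//= lerDr sumr_ge0.
Qed.

HB.instance Definition _ := Lmodule_isNormed.Build R ell1
  ell1_normD ell1_normZ ell1_norm_eq0.

End ell1.
Arguments ell1 : clear implicits.

Definition isomorphic_copy (R : realType) (F E : tvsType R) (L : set E) :=
  submod_closed (mem L) /\
  exists (f : {linear F -> E}) (g : E -> F),
    [/\ set_fun setT L f, cancel f g, {in L, cancel g f},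
        continuous f & {within L, continuous g}].

(* Main.v *)
Require Import Defs.
From HB Require Import structures.
From mathcomp Require Import all_boot all_order all_algebra.
From mathcomp Require Import all_classical all_reals all_analysis.
From mathcomp Require Import ring lra.

(* (i) => (ii).  Let [D] be a bounded set with [0] in its weak closure.  By
   compactness of the polars [K_m] of a base of neighbourhoods, [D] contains a
   sequence [d_n] such that, for every [m], the indices cannot be covered by [m]
   sets {n | h (d_n) >= 1} with [h] in [K_m]; the sets of indices with this
   property form a coideal.  Either this coideal is selective, and the Ramsey
   theorem for selective coideals, applied to the finite sets of indices covered
   by a single [h] in [K_m], yields a weakly null subsequence; or there are
   consecutive finite blocks all of whose selectors are covered by [m]
   functionals of [K_m], although [k] functionals of [K_k] never cover the k-th
   block, and a tree construction then extracts a sequence on which the elements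
   of [K_m] realize every pattern of values >= 1 and <= 1/2, i.e. an l1-sequence.
   Hence, without copy of l1, bounded sets are Frechet-Urysohn in the weak
   topology, and Frechet-Urysohn spaces are Ascoli.

   (ii) => (i).  In the unit ball [B] of a copy of l1 let
   [f_n y = max (|y_n| - 1/4) 0].  A gliding hump argument shows that [f_n]
   vanishes on any given weakly compact subset of [B] for [n] large, so
   [{0} u {f_n}] is compact in [C_k(B)]; it is not evenly continuous at [(0, 0)]
   because [f_n ((e_m - e_n) / 2) = 1/4], while every weak neighbourhood of [0]
   contains [(e_m - e_n) / 2] for some arbitrarily large [m < n]. *)

Set Implicit Arguments.
Unset Strict Implicit.
Unset Printing Implicit Defensive.

Import Order.TTheory GRing.Theory Num.Theory.
Import numFieldNormedType.Exports.

Local Open Scope classical_set_scope.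
Local Open Scope ring_scope.

(** * Ramsey theorem for selective coideals *)

Section Coideals.
Local Open Scope nat_scope.

(** The last clause is the diagonalization property of Mathias's happy families: the part of [D]
    above any of its elements [m] lies in [B m]. *)
Definition selective_coideal (H : set (set nat)) :=
  [/\ forall A B : set nat, H A -> A `<=` B -> H B,
      forall A B : set nat, H (A `|` B) -> H A \/ H B,
      forall A : set nat, H A -> infinite_set A
    & forall B : nat -> set nat,
        (forall n, H (B n)) -> (forall n, B n.+1 `<=` B n) ->
        exists D : set nat, [/\ H D, D `<=` B 0
          & forall m n, D m -> D n -> m < n -> B m n]].

Definition finitely_in (G : set (set nat)) (M : set nat) :=
  forall F : set nat, finite_set F -> F `<=` M -> G F.

(** The sets [M] with [finitely_in G M] form a closed family. In Galvin-Prikry terms, [B] kills [s]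
    when it accepts [s] for the open complement. *)
Definition kills (G : set (set nat)) (s B : set nat) :=
  forall M, M `<=` B -> infinite_set M -> ~ finitely_in G (s `|` M).

Lemma finitely_in_sub G M M' : M' `<=` M -> finitely_in G M -> finitely_in G M'.
Proof. by move=> M'M GM F finF FM'; apply: GM => // x /FM'/M'M. Qed.

Lemma kills_sub G s B B' : B' `<=` B -> kills G s B -> kills G s B'.
Proof. by move=> B'B kB M MB'; apply: kB => x /MB'/B'B. Qed.

Lemma infinite_above (M : set nat) k : infinite_set M ->
  infinite_set (M `&` [set n | k < n]).
Proof.
move=> iM fM; apply: iM.
apply: (@sub_finite_set _ _ ((M `&` [set n | k < n]) `|` `I_k.+1)).
  by move=> x Mx; have [kx|kx] := ltnP k x; [left|right].
by rewrite finite_setU; split => //; exact: finite_II.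
Qed.

(** An infinite [M] stays infinite when a finite part is dropped, and [finitely_in] passes to
    subsets, so only the tail of [B] matters. *)
Lemma kills_above G s B k : kills G s (B `&` [set n | k < n]) -> kills G s B.
Proof.
move=> kB M MB iM /(@finitely_in_sub _ _ (s `|` (M `&` [set n | k < n]))) h.
apply: (kB _ _ (infinite_above iM) (h _)); first by move=> x [Mx kx]; split; auto.
by move=> x [|[]]; [left|right].
Qed.

Lemma subset_IIS (s : set nat) n : s `<=` `I_n.+1 ->
  s `<=` `I_n \/ exists2 t, t `<=` `I_n & s = t `|` [set n].
Proof.
move=> sn; have [sn'|nsn'] := pselect (s n); [right|left].
  exists (s `\` [set n]).
    by move=> x [/sn /=]; rewrite ltnS leq_eqVlt => /orP[/eqP ->|].
  by apply/seteqP; split=> x; [case: (eqVneq x n) => [->|/eqP]; [right|left]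
    |case=> [[]//|->]].
by move=> x sx; have := sn _ sx => /=; rewrite ltnS leq_eqVlt => /orP[/eqP xn|//];
  rewrite xn in sx.
Qed.

Lemma subset_II0 (s : set nat) : s `<=` `I_0 -> s = set0.
Proof. by move=> s0; apply/seteqP; split => x // /s0. Qed.

Lemma subset_II_max n (s : set nat) : s `<=` `I_n ->
  s = set0 \/ exists2 m, s m & s `<=` `I_m.+1.
Proof.
elim: n => [/subset_II0|n IH]; [by left|].
move=> /subset_IIS[/IH//|[t tn ->]]; right; exists n; first by right.
by move=> x [/tn /ltnW|->] /=.
Qed.

Variable H : set (set nat).
Hypothesis Hsel : selective_coideal H.

Let Hup : forall A B : set nat, H A -> A `<=` B -> H B.
Proof. by case: Hsel. Qed.
Let Hinf : forall A : set nat, H A -> infinite_set A.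
Proof. by case: Hsel. Qed.

(** Induction handles the finitely many [s] in turn, splitting them by whether they contain [n];
    heredity of [P] preserves earlier decisions. *)
Lemma coideal_decide n (P : set nat -> set nat -> Prop) :
  (forall s B B', B' `<=` B -> P s B -> P s B') ->
  (forall s B, H B -> exists B', [/\ B' `<=` B, H B' & P s B']) ->
  forall B, H B -> exists B',
    [/\ B' `<=` B, H B' & forall s, s `<=` `I_n -> P s B'].
Proof.
elim: n P => [|n IH] P Psub Pdec B HB.
  have [B' [B'B HB' PB']] := Pdec set0 B HB.
  by exists B'; split => // s /subset_II0 ->.
have [B1 [B1B HB1 PB1]] := IH P Psub Pdec B HB.
have [B2 [B2B1 HB2 PB2]] := IH (fun s => P (s `|` [set n]))
  (fun s => Psub _) (fun s => Pdec _) B1 HB1.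
exists B2; split => //; first exact: subset_trans B1B.
by move=> s /subset_IIS[/PB1/(Psub _ _ _ B2B1)//|[t /PB2 tn ->]].
Qed.

(** By the partition property, removing a set outside [H] from a set in [H] leaves a set in [H]; the
    finitely many [Z s] are removed in turn. *)
Lemma coideal_avoid n (Z : set nat -> set nat) :
  (forall s, s `<=` `I_n -> ~ H (Z s)) -> forall B, H B ->
  H [set x | B x /\ forall s, s `<=` `I_n -> ~ Z s x].
Proof.
have [_ Hpart _ _] := Hsel.
have avoid1 A B : H B -> ~ H A -> H (B `\` A).
  move=> HB nA; have [] := Hpart (B `\` A) A => //.
  by apply: Hup HB _ => x Bx; have [|] := pselect (A x); [right|left].
elim: n Z => [|n IH] Z nZ B HB.
  apply: Hup (avoid1 (Z set0) B HB (nZ _ _)) _ => // x [Bx nZx].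
  by split => // s /subset_II0 ->.
have H1 : H [set x | B x /\ forall s, s `<=` `I_n -> ~ Z s x].
  by apply: IH => // s sn; apply: nZ => x /sn /= /ltnW.
apply: Hup (IH (fun s => Z (s `|` [set n])) _ _ H1) _ => [s sn|x].
  by apply: nZ => x [/sn /= /ltnW//|->] /=.
move=> [[Bx nZx] nZx']; split => // s /subset_IIS[/nZx//|[t tn ->]].
exact: nZx'.
Qed.

Lemma exists_ub_in (B s : set nat) : infinite_set B -> finite_set s ->
  exists2 n, B n & s `<=` `I_n.
Proof.
move=> iB fs; apply: contrapT => nB; apply: iB.
apply: (@sub_finite_set _ _ (\bigcup_(x in s) `I_x.+1)); last first.
  by apply: bigcup_finite => // x _; exact: finite_II.
move=> n Bn; apply: contrapT => nn; apply: nB; exists n => // x sx /=.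
by rewrite ltnNge; apply/negP => nx; apply: nn; exists x.
Qed.

(** If no set of [H] below [B] kills the empty set, two diagonalizations follow: [D] decides each of
    its finite subsets, and every finite subset of [T] is robust, hence not killed by [D], hence in
    [G]. *)
Theorem coideal_ramsey (G : set (set nat)) (B : set nat) : H B ->
  exists B', [/\ B' `<=` B, H B' & kills G set0 B' \/ finitely_in G B'].
Proof.
have [_ _ _ Hdiag] := Hsel.
move=> HB; have [[B' [B'B HB' kB']]|nkill] :=
  pselect (exists B', [/\ B' `<=` B, H B' & kills G set0 B']).
  by exists B'; split => //; left.
pose robust s A := forall A', A' `<=` A -> H A' -> ~ kills G s A'.
pose P s A := kills G s A \/ robust s A.
have Psub s A A' : A' `<=` A -> P s A -> P s A'.
  move=> A'A [kA|rA]; [left; exact: kills_sub kA|right].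
  by move=> A'' A''A'; apply: rA; exact: subset_trans A'A.
have Pdec s A : H A -> exists A', [/\ A' `<=` A, H A' & P s A'].
  move=> HA; have [[A' [A'A HA' kA']]|nA] :=
    pselect (exists A', [/\ A' `<=` A, H A' & kills G s A']).
    by exists A'; split => //; left.
  by exists A; split => //; right=> A' A'A HA' kA'; apply: nA; exists A'.
(* [C n] decides all [s] with elements at most [n], and the part of the diagonal above [n] lies in
   [C n]; [kills_above] disposes of the rest. *)
have [D [HD DB PD]] : exists D, [/\ H D, D `<=` B &
    forall s, finite_set s -> s `<=` D -> P s D].
  have st n (A : {A | H A}) : {A' | H A' /\
      (A' `<=` sval A /\ forall s, s `<=` `I_n.+1 -> P s A')}.
    apply: cid; have [A' [? ? ?]] := coideal_decide n.+1 Psub Pdec (svalP A).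
    by exists A'.
  pose st' n A := exist H _ (svalP (st n A)).1.
  pose C := fix C n := if n is n'.+1 then st' n (C n') else st' 0 (exist _ B HB).
  have CP n s : s `<=` `I_n.+1 -> P s (sval (C n)).
    by case: n => [|n]; [exact: (svalP (st 0 _)).2.2
                        |exact: (svalP (st n.+1 _)).2.2].
  have [|n|D [HD D0 DC]] := Hdiag (fun n => sval (C n)).
  - by move=> n; exact: svalP.
  - exact: (svalP (st n.+1 _)).2.1.
  exists D; split => //; first by apply: (subset_trans D0); exact: (svalP (st 0 _)).2.1.
  move=> s fs sD; have [n Dn sn] := exists_ub_in (Hinf HD) fs.
  have : P s (D `&` [set m | n < m]).
    apply: (Psub _ (sval (C n))) => [x [Dx nx]|]; first exact: DC.
    by apply: CP => x /sn /= /ltnW.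
  move=> [/kills_above|r]; [by left|right] => A AD HA kA.
  apply: (r (A `&` [set m | n < m])).
  - by move=> x [/AD]; split.
  - have [_ Hpart _ _] := Hsel.
    have := Hpart (A `&` [set m | n < m]) (A `&` `I_n.+1).
    case => //; last by move/Hinf; case; apply: finite_setIr; exact: finite_II.
    apply: Hup HA _ => x Ax.
    by have [nx|nx] := ltnP n x; [left|right]; split.
  - by apply: kills_sub kA => x [].
have rob0 : robust set0 D.
  move=> A AD HA kA; apply: nkill; exists A; split => //.
  exact: subset_trans DB.
pose Z s := [set x | D x /\ robust s D /\ kills G (s `|` [set x]) D].
(* If [Z s] were in [H], it would kill [s], against robustness: for [x] in a surviving [M], the tail
   of [M] above [x] would survive with [s] and [x], which [D] excludes. *)
have nZ n s : s `<=` `I_n -> ~ H (Z s).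
  move=> sn HZ; have [_ [_ [rs _]]] := infinite_setN0 (Hinf HZ).
  apply: (rs (Z s)) => //; first by move=> y [].
  move=> M MZ iM GM; have [x Mx] := infinite_setN0 iM.
  have [_ [_ kx]] := MZ _ Mx.
  apply: (kx (M `&` [set m | x < m])) => //.
  - by move=> y [/MZ[]].
  - exact: infinite_above.
  - by apply: finitely_in_sub GM => y [[|->]|[]]; [left|right|right].
pose E n := [set x | D x /\ forall s, s `<=` `I_n -> ~ Z s x].
have [|n|T [HT T0 TE]] := Hdiag (fun n => E n.+1).
- by move=> n; apply: coideal_avoid => // s; exact: nZ.
- by move=> x [Dx nx]; split => // s sn; apply: nx => y /sn /= /ltnW.
have TD : T `<=` D by move=> x /T0[].
exists T; split; [exact: subset_trans DB|by []|right].
(* Induction on a bound of [s]: if [n] is the largest element, the rest [t] is robust, and the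
   choice of [T] keeps [n] out of [Z t], so [D] cannot kill [s]. *)
have robT n : forall s, s `<=` T `&` `I_n -> robust s D.
  elim: n => [|n IH] s sT.
    by rewrite (@subset_II0 s)// => x /sT[].
  have [sn|[t tn st]] := @subset_IIS s n (fun x sx => (sT x sx).2).
    by apply: IH => x sx; split; [exact: (sT _ sx).1|exact: sn].
  have tT : t `<=` T `&` `I_n.
    by move=> x tx; split; [apply: (sT x _).1; rewrite st; left|exact: tn].
  have Tn : T n by apply: (sT n _).1; rewrite st; right.
  have fs : finite_set s.
    by apply: (@sub_finite_set _ _ `I_n.+1); [move=> x /sT[]|exact: finite_II].
  have sD : s `<=` D by move=> x /sT[/TD].
  have [ks|//] := PD s fs sD.
  have nZt : ~ Z t n.
    have [t0|[m tm tm1]] := subset_II_max tn.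
      by have [_] := T0 _ Tn; apply; rewrite t0.
    have [_] := TE m n (tT _ tm).1 Tn (tn _ tm); exact.
  by case: nZt; split; [exact: TD|split; [exact: IH|rewrite -st]].
move=> F fF FT.
have [n Tn Fn] := exists_ub_in (Hinf HT) fF.
have rF : robust F D by apply: (robT n) => x Fx; split; auto.
apply: contrapT => nGF; apply: (rF D (@subset_refl _ D) HD) => M _ _ GM.
by apply: nGF; apply: GM => // x Fx; left.
Qed.
End Coideals.

(** * Strong subtrees of the binary tree *)

Section StrongSubtree.
Local Open Scope nat_scope.

(* Nodes of the binary tree are lists of bits with the most recent bit first,
   so that the extensions of [v] are the lists [t ++ v]. *)
Fixpoint bitseqs n : seq (seq bool) :=
  if n is n'.+1 then [seq b :: v | b <- [:: true; false], v <- bitseqs n']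
  else [:: [::]].

Lemma mem_bitseqs n v : (v \in bitseqs n) = (size v == n).
Proof.
elim: n v => [|n IH] [|b v]; rewrite ?inE//; first by apply/negbTE/negP => /allpairsP[[? ?] /= []].
rewrite [RHS]eqSS -IH; apply/allpairsP/idP => [[[b' w] /= [_ ? [_ ->]]]//|vn].
by exists (b, v); split => //=; case: (b).
Qed.

(** Induction on the list of colours. Either the first colour [i] is avoided above some node on
    infinitely many levels, and is discarded; or finitely many nodes always have extensions of
    colour [i] on a common level, and the subtree is built level by level. *)
Lemma strong_subtree (c : seq bool -> nat) (S : seq nat) (v0 : seq bool)
    (L : set nat) : infinite_set L ->
  (forall t, L (size (t ++ v0)) -> c (t ++ v0) \in S) ->
  exists (i : nat) (l : nat -> nat) (e : seq bool -> seq bool),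
    [/\ forall v, size (e v) = l (size v), forall v, c (e v) = i
      & forall b v, exists t, e (b :: v) = t ++ b :: e v].
Proof.
elim: S v0 L => [|i S IH] v0 L iL cS.
  have [n [Ln ln]] := infinite_setN0 (infinite_above (k := size v0) iL).
  have /cS // : L (size (nseq (n - size v0) true ++ v0)).
  by rewrite size_cat size_nseq subnK // ltnW.
have [[v1 [L' [iL' cL']]]|nS] := pselect (exists v1 L', infinite_set L' /\
    forall t, L' (size (t ++ v1)) -> c (t ++ v1) \in S).
  exact: IH iL' cL'.
(* Above each node of [vs] only finitely many levels of [L] miss colour [i], so one level of [L]
   serves all of [vs]. *)
have up (vs : seq (seq bool)) : (forall v, v \in vs -> exists t, v = t ++ v0) ->
    exists l (h : seq bool -> seq bool), forall v, v \in vs ->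
      [/\ size (h v) = l, c (h v) = i & exists t, h v = t ++ v].
  move=> vsv0; have key v : v \in vs ->
      finite_set (L `&` [set l | forall t, size (t ++ v) = l -> c (t ++ v) \in S]).
    move=> vvs; apply: contrapT => iL'; apply: nS.
    by exists v; eexists; split; [exact: iL'|move=> t [_]; exact].
  have : finite_set (\bigcup_(v in [set` vs])
      (L `&` [set l | forall t, size (t ++ v) = l -> c (t ++ v) \in S])).
    by apply: bigcup_finite => // v; exact: key.
  move=> /(infinite_setD iL)/infinite_setN0[l [Ll nl]].
  have hv v : exists w, v \in vs -> [/\ size w = l, c w = i & exists t, w = t ++ v].
    have [vvs|] := boolP (v \in vs); last by exists [::].
    have /existsNP[t /not_implyP[sl nc]] :
        ~ forall t, size (t ++ v) = l -> c (t ++ v) \in S.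
      by move=> h; apply: nl; exists v.
    exists (t ++ v) => _; split => //; last by exists t.
    have [t' v't] := vsv0 v vvs; move: nc (cS (t ++ t')).
    rewrite -catA -v't sl => nc /(_ Ll); rewrite inE => /orP[/eqP//|//].
  by have [h hP] := choice hv; exists l, h.
have [l0 [h0]] := up [:: v0] (fun v => ltac:(rewrite inE => /eqP ->; exists [::]; done)).
move=> /(_ v0); rewrite inE eqxx => /(_ isT)[sh0 ch0 [t0 t0E]].
pose inv k (s : nat * (seq bool -> seq bool)) := forall v, size v = k ->
  [/\ size (s.2 v) = s.1, c (s.2 v) = i & exists t, s.2 v = t ++ v0].
have step k (s : {s | inv k s}) : {s' | inv k.+1 s' /\
    forall b v, size v = k -> exists t, s'.2 (b :: v) = t ++ b :: (sval s).2 v}.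
  case: s => -[l e] /= ie; apply: cid.
  have [|l' [h hP]] := up [seq b :: e v | b <- [:: true; false], v <- bitseqs k].
    move=> _ /allpairsP[[b v] /= [_ + ->]]; rewrite mem_bitseqs => /eqP sv.
    by have [_ _ [t /= ->]] := ie v sv; exists (b :: t).
  have mem b v : size v = k ->
      b :: e v \in [seq b :: e v | b <- [:: true; false], v <- bitseqs k].
    move=> <-; apply: allpairs_f; last by rewrite mem_bitseqs.
    by case: b; rewrite !inE.
  exists (l', fun u => if u is b :: v then h (b :: e v) else [::]); split.
    move=> [//|b v] [sv]; have [? ? [t tE]] := hP _ (mem b v sv); split => //=.
    by have [_ _ [t' /= t'E]] := ie v sv; exists (t ++ b :: t'); rewrite tE t'E -catA.
  by move=> b v sv; have [_ _ [t ?]] := hP _ (mem b v sv); exists t.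
have inv0 : inv 0 (l0, fun=> h0 v0).
  by move=> v _; split => //; exists t0.
pose st := fix st k : {s | inv k s} :=
  if k is k'.+1 then exist _ _ (svalP (step k' (st k'))).1 else exist _ _ inv0.
exists i, (fun k => (sval (st k)).1), (fun v => (sval (st (size v))).2 v); split.
- by move=> v; have [] := svalP (st (size v)) v erefl.
- by move=> v; have [] := svalP (st (size v)) v erefl.
- by move=> b v; have [t tE] := (svalP (step (size v) (st (size v)))).2 b v erefl; exists t.
Qed.

End StrongSubtree.

(** * Selectivity or shattering *)

Section Coverings.
Local Open Scope nat_scope.

Variables (X : eqType) (K : nat -> set X) (hi lo : X -> nat -> Prop).
Variable dbl : X -> X.
Hypothesis K_mono : forall m n, m <= n -> K m `<=` K n.
Hypothesis K_dbl : forall m x, K m x -> K (m + m) (dbl x).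
Hypothesis dbl_lo : forall x n, ~ hi (dbl x) n -> lo x n.
Hypothesis hi_ex : forall n, exists m x, K m x /\ hi x n.

Definition tuples m (xs : seq X) := size xs <= m /\ forall x, x \in xs -> K m x.

(* [hi x n] reads [h (d n) >= 1] and [lo x n] reads [h (d n) <= 1/2], for the
   functional [x = h] and the n-th vector [d n] of a fixed sequence. *)
Definition covers (xs : seq X) n := exists2 x, x \in xs & hi x n.

Definition large m (F : set nat) :=
  forall xs, tuples m xs -> exists2 n, F n & ~ covers xs n.

(** Finite witnesses allow consecutive finite blocks to be cut out of positive sets. *)
Definition positive_set : set (set nat) :=
  [set B | forall m, exists F, [/\ finite_set F, F `<=` B & large m F]].

(** Finitary form of Rosenthal's independent sequences, with one [m] for all patterns. *)
Definition shattered := exists m (g : nat -> nat), forall N (b : nat -> bool),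
  exists2 x, K m x & forall k, k < N -> if b k then hi x (g k) else lo x (g k).

Lemma tuples_cat m1 m2 xs1 xs2 : tuples m1 xs1 -> tuples m2 xs2 ->
  tuples (m1 + m2) (xs1 ++ xs2).
Proof.
move=> [s1 K1] [s2 K2]; split; first by rewrite size_cat leq_add.
move=> x; rewrite mem_cat => /orP[/K1|/K2]; apply: K_mono.
  exact: leq_addr.
exact: leq_addl.
Qed.

Lemma covers_catl xs ys n : covers xs n -> covers (xs ++ ys) n.
Proof. by move=> [x xxs hx]; exists x => //; rewrite mem_cat xxs. Qed.

Lemma covers_catr xs ys n : covers ys n -> covers (xs ++ ys) n.
Proof. by move=> [x xxs hx]; exists x => //; rewrite mem_cat xxs orbT. Qed.

Lemma positive_up A B : positive_set A -> A `<=` B -> positive_set B.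
Proof.
move=> pA AB m; have [F [fF FA lF]] := pA m.
by exists F; split => //; exact: subset_trans AB.
Qed.

(** If [A] fails at [m1] and [B] at [m2], a witness [F] for [m1 + m2] splits into two parts, each
    covered by a tuple, and the concatenation covers [F]. *)
Lemma positive_part A B : positive_set (A `|` B) -> positive_set A \/ positive_set B.
Proof.
move=> pAB; apply: contrapT => /not_orP[/existsNP[m1 n1] /existsNP[m2 n2]].
have [F [fF FAB lF]] := pAB (m1 + m2).
have sub C m : ~ (exists F, [/\ finite_set F, F `<=` C & large m F]) ->
    exists2 xs, tuples m xs & forall n, F n -> C n -> covers xs n.
  move=> nC; have /existsNP[xs /not_implyP[txs nxs]] : ~ large m (F `&` C).
    move=> lFC; apply: nC; exists (F `&` C); split=> [|x []|] //.
    by apply: sub_finite_set fF => x [].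
  exists xs => // n Fn Cn; apply: contrapT => nc; apply: nxs.
  by exists n.
have [xs1 t1 c1] := sub _ _ n1; have [xs2 t2 c2] := sub _ _ n2.
have [n Fn] := lF _ (tuples_cat t1 t2); apply.
by have [/(c1 _ Fn)|/(c2 _ Fn)] := FAB _ Fn;
  [exact: covers_catl|exact: covers_catr].
Qed.

(** Finitely many indices are covered by one tuple, with one functional from [hi_ex] for each
    index. *)
Lemma positive_infinite A : positive_set A -> infinite_set A.
Proof.
move=> pA fA; have [n _ An] := exists_ub_in infinite_nat fA.
have [m [xs txs cxs]] : exists m, exists2 xs, tuples m xs &
    forall i, i < n -> covers xs i.
  elim: (n) => [|k [m [xs txs cxs]]]; first by exists 0, [::].
  have [m' [x [Kx hx]]] := hi_ex k; exists (m + m'.+1), (xs ++ [:: x]).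
    apply: tuples_cat => //; split => // y; rewrite inE => /eqP ->.
    exact: K_mono Kx.
  move=> i; rewrite ltnS leq_eqVlt => /orP[/eqP ->|/cxs]; last exact: covers_catl.
  by apply: covers_catr; exists x => //; rewrite inE.
have [F [_ FA lF]] := pA m.
by have [i /FA/An/= /cxs] := lF _ txs.
Qed.

Lemma positive_above A k : positive_set A -> positive_set (A `&` [set n | k < n]).
Proof.
move=> pA; have [] := @positive_part (A `&` [set n | k < n]) `I_k.+1 => //.
  apply: positive_up pA _ => x Ax.
  by have [kx|kx] := ltnP k x; [left|right].
by move/positive_infinite; case; exact: finite_II.
Qed.

(** * Selectors of finite blocks *)

Section Blocks.
Variable F : nat -> set nat.
Hypothesis F_fin : forall k, finite_set (F k).
Hypothesis F_large : forall k, large k (F k).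

Definition selector (phi : nat -> nat) := forall k, F k (phi k).

(** The tuple may depend on [k1], so that failure is witnessed on a finite interval of blocks and
    bad selectors can be concatenated. *)
Definition good_from k0 (C : set (seq X)) := forall k1 phi, selector phi ->
  exists2 xs, C xs & forall k, k0 <= k < k1 -> covers xs (phi k).

Definition good C := exists k0, good_from k0 C.

Lemma selector_ex : exists phi, selector phi.
Proof.
have /choice[phi] : forall k, exists n, F k n; last by exists phi.
by move=> k; have [|n Fn _] := @F_large k [::]; [split|exists n].
Qed.

Lemma good_from_le k0 k1 C : k0 <= k1 -> good_from k0 C -> good_from k1 C.
Proof.
move=> k01 gC k2 phi sphi; have [xs Cxs cxs] := gC k2 phi sphi.
exists xs => // k /andP[k1k kk2]; apply: cxs.
by rewrite kk2 (leq_trans k01).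
Qed.

Lemma good_nonempty C : good C -> C !=set0.
Proof.
move=> [k0 gC]; have [phi sphi] := selector_ex.
by have [xs Cxs _] := gC 0 phi sphi; exists xs.
Qed.

Lemma good_sub C C' : C `<=` C' -> good C -> good C'.
Proof.
move=> CC' [k0 gC]; exists k0 => k1 phi /(gC k1)[xs /CC' Cxs cxs].
by exists xs.
Qed.

Lemma not_goodP C : ~ good C -> forall k0, exists k1 phi, [/\ k0 <= k1,
  selector phi & forall xs, C xs -> exists2 k, k0 <= k < k1 & ~ covers xs (phi k)].
Proof.
move=> /forallNP nC k0; move: (nC k0) => /existsNP[k1 /existsNP[phi]].
move=> /not_implyP[sphi ncov]; exists (maxn k0 k1), phi; split => //.
  exact: leq_maxl.
move=> xs Cxs; apply: contrapT => nk; apply: ncov; exists xs => // k /andP[k0k kk1].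
apply: contrapT => nc; apply: nk; exists k => //; rewrite k0k /=.
by rewrite (leq_trans kk1)// leq_maxr.
Qed.

(* A bad selector for [C1] up to [k1], followed by a bad one for [C2], is bad for
   the union. *)
Lemma good_setU C1 C2 : good (C1 `|` C2) -> good C1 \/ good C2.
Proof.
move=> [k0 gC]; apply: contrapT => /not_orP[/not_goodP n1 /not_goodP n2].
have [k1 [phi1 [k01 s1 P1]]] := n1 k0.
have [k2 [phi2 [k12 s2 P2]]] := n2 k1.
have [|xs Cxs cxs] := gC k2 (fun k => if k < k1 then phi1 k else phi2 k).
  by move=> k; case: ifP.
have [C1x|C2x] := Cxs.
  have [k /andP[k0k kk1]] := P1 _ C1x; apply.
  by have := cxs k; rewrite kk1 k0k (leq_trans kk1)//=; apply.
have [k /andP[k1k kk2]] := P2 _ C2x; apply.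
by have := cxs k; rewrite [k < k1]ltnNge k1k/= kk2 (leq_trans k01)//=; apply.
Qed.

Lemma good_bigcup (I : choiceType) (J : set I) (C : I -> set (seq X)) :
  finite_set J -> good (\bigcup_(i in J) C i) -> exists2 i, J i & good (C i).
Proof.
move=> /finite_seqP[s ->]; elim: s => [|i s IH].
  by move=> /good_nonempty[xs [i]]; rewrite /= inE.
move=> gU; have : good (C i `|` \bigcup_(j in [set` s]) C j).
  apply: good_sub gU => x [j /=]; rewrite inE => /orP[/eqP ->|js Cx]; first by left.
  by right; exists j.
move=> /good_setU[gi|/IH[j js gj]]; first by exists i => //=; rewrite inE eqxx.
by exists j => //=; rewrite inE js orbT.
Qed.

(** For each [m] some selector is covered by no element of [tuples m] on a finite interval of
    blocks; splicing these along consecutive intervals gives a range with a large part for every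
    [m]. *)
Lemma selector_positive : (forall m, ~ good (tuples m)) ->
  exists2 phi, selector phi & positive_set (range phi).
Proof.
move=> ng; have key m k0 : {p : nat * (nat -> nat) | [/\ k0 < p.1, selector p.2 &
    forall xs, tuples m xs -> exists2 k, k0 <= k < p.1 & ~ covers xs (p.2 k)]}.
  apply: cid; have [k1 [phi [k01 s P]]] := not_goodP (ng m) k0.
  (* The successor makes [kk] strictly increasing, whence [m <= kk m]. *)
  exists (k1.+1, phi); split => //= xs /P[k /andP[k0k kk1] nc].
  by exists k => //; rewrite k0k ltnW.
pose kk := fix kk m := if m is m'.+1 then (sval (key m' (kk m'))).1 else 0.
have kkS m : kk m < kk m.+1 by have [] := svalP (key m (kk m)).
have kk_ge m : m <= kk m.
  by elim: m => // m IH; exact: leq_trans (kkS m).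
pose Phi := fix Phi m := if m is m'.+1 then
    fun k => if k < kk m' then Phi m' k else (sval (key m' (kk m'))).2 k
  else sval (cid selector_ex).
have sPhi m : selector (Phi m).
  elim: m => [|m IH]; first exact: svalP.
  by move=> k /=; case: ifP => // _; have [_ + _] := svalP (key m (kk m)); exact.
have stab m n k : k < kk m -> m <= n -> Phi n k = Phi m k.
  move=> km; elim: n => [|n IH]; first by rewrite leqn0 => /eqP <-.
  rewrite leq_eqVlt => /orP[/eqP <-//|]; rewrite ltnS => mn /=.
  rewrite (leq_trans km) ?IH//.
  elim: (n) mn => [|n' IHn]; first by rewrite leqn0 => /eqP <-.
  rewrite leq_eqVlt => /orP[/eqP <-//|/IHn]; move/leq_trans; apply.
  exact/ltnW.
(* Since [k < kk k.+1], the value of [Phi n] at [k] is constant from [n = k.+1] on. *)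
exists (fun k => Phi k.+1 k); first by move=> k; exact: sPhi.
move=> m; exists [set Phi k.+1 k | k in `I_(kk m.+1)]; split.
- by apply: finite_image; exact: finite_II.
- by move=> _ [k _ <-]; exists k.
- move=> xs txs; have [_ _ /(_ xs txs)[k /andP[k0k kk1] nc]] := svalP (key m (kk m)).
  exists (Phi k.+1 k); first by exists k.
  suff -> : Phi k.+1 k = (sval (key m (kk m))).2 k by [].
  have -> : (sval (key m (kk m))).2 k = Phi m.+1 k by rewrite /= ltnNge k0k.
  by have [km|/ltnW km] := leqP m k; [apply: stab|apply/esym/stab] => //;
    exact: kk_ge.
Qed.

(** Altering a selector to take the value [n] at block [k] does not affect later blocks, and a tuple
    covering the altered selector covers [n]. *)
Lemma good_hi n k k0 C : F k n -> k0 <= k -> good_from k0 C ->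
  good_from k.+1 [set xs | C xs /\ covers xs n].
Proof.
move=> Fn k0k gC k1 phi sphi.
have [|xs Cxs cxs] := gC (maxn k1 k.+1) (fun j => if j == k then n else phi j).
  by move=> j; case: eqP => // ->.
exists xs; last first.
  move=> j /andP[kj jk1]; have := cxs j.
  rewrite (gtn_eqF kj); apply.
  by rewrite (leq_trans k0k (ltnW kj)) leq_max jk1.
by split => //; have := cxs k; rewrite eqxx; apply; rewrite k0k leq_max leqnn orbT.
Qed.

(** The splitting step of the tree: a single [n] must serve all nodes [i] of a level, leaving a good
    family on both the low and the high branch. *)
Lemma good_branch m (I : choiceType) (L : seq I) (C : I -> set (seq X)) (x0 : X) :
  (forall i, i \in L -> good (C i) /\ C i `<=` tuples m) ->
  exists n, forall i, i \in L ->
    good [set xs | C i xs /\ forall x, x \in xs -> lo x n] /\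
    exists c, [/\ c < m & good [set xs | [/\ C i xs, c < size xs & hi (nth x0 xs c) n]]].
Proof.
move=> gL.
have [k0 gk0] : exists k0, forall i, i \in L -> good_from k0 (C i).
  elim: L gL => [|i L IH] gL; first by exists 0.
  have [|k0 gk0] := IH; first by move=> j jL; apply: gL; rewrite inE jL orbT.
  have [[k1 gk1] _] := gL i (mem_head _ _); exists (maxn k0 k1) => j.
  rewrite inE => /orP[/eqP ->|/gk0].
    exact: good_from_le (leq_maxr _ _) gk1.
  exact: good_from_le (leq_maxl _ _).
(* [F k] has to escape the doubled members of [size L] tuples, that is, at most [size L * m]
   functionals of [K (m + m)]. *)
pose k := maxn k0 (maxn (m + m) (size L * m)).
have [n Fn nlo] : exists2 n, F k n & forall i, i \in L ->
    good [set xs | C i xs /\ forall x, x \in xs -> lo x n].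
  apply: contrapT => nn.
  pose bad i := [set n | F k n /\ ~ good [set xs | C i xs /\ forall x, x \in xs -> lo x n]].
  (* By [good_bigcup] the tuples low at some bad index do not exhaust [C i], so some tuple of [C i]
     is low at no bad index. *)
  have wit i : exists xs, i \in L -> tuples m xs /\
      forall n, bad i n -> ~ forall x, x \in xs -> lo x n.
    have [iL|] := boolP (i \in L); last by exists [::].
    apply: contrapT => nxs; have fbad : finite_set (bad i).
      by apply: sub_finite_set (F_fin k) => x [].
    have [gi ti] := gL i iL.
    have [|n [Fn]] := @good_bigcup _ _
      (fun n => [set xs | C i xs /\ forall x, x \in xs -> lo x n]) fbad; last by [].
    apply: good_sub gi => xs Cxs; apply: contrapT => nb; apply: nxs.
    exists xs => _; split; first exact: ti.
    by move=> n bn lon; apply: nb; exists n.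
  have [w wP] := choice wit.
  (* An index of [F k] missed by all doubled functionals makes every [w i] low there, so it is bad
     for no [i]. *)
  pose ys := flatten [seq map dbl (w i) | i <- L].
  have [n Fn ncov] : exists2 n, F k n & ~ covers ys n.
    apply: F_large; split; last first.
      move=> y /flatten_mapP[i iL /mapP[x xw ->]].
      have [[_ Kw] _] := wP i iL; apply: K_mono (K_dbl (Kw x xw)).
      by rewrite !leq_max leqnn !orbT.
    apply: (@leq_trans (size L * m)); last by rewrite !leq_max leqnn !orbT.
    have sw i : i \in L -> size (w i) <= m by move=> /wP[[]].
    rewrite /ys; elim: (L) sw => // i s IH sw; rewrite /= size_cat size_map mulSn.
    by apply: leq_add; [apply: sw|apply: IH => j js; apply: sw];
      rewrite inE ?eqxx// js orbT.
  apply: nn; exists n => // i iL; apply: contrapT => ngi.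
  have [_ /(_ n)] := wP i iL; apply => // x xw.
  apply: dbl_lo => hx; apply: ncov; exists (dbl x) => //.
  by apply/flatten_mapP; exists i => //; exact: map_f.
exists n => i iL; split; first exact: nlo.
have [_ tC] := gL i iL.
have gcov : good [set xs | C i xs /\ covers xs n].
  by exists k.+1; apply: good_hi Fn _ (gk0 i iL); rewrite leq_maxl.
(* A covering tuple is high at one of its at most [m] positions; by [good_bigcup] one position gives
   a good subfamily. *)
have [|c cm gc] := @good_bigcup _ `I_m
  (fun c => [set xs | [/\ C i xs, c < size xs & hi (nth x0 xs c) n]]) (finite_II _).
  apply: good_sub gcov => xs [Cxs [x xxs hx]].
  have [sxs _] := tC _ Cxs.
  exists (index x xs); first by rewrite /= (leq_trans _ sxs)// index_mem.
  by split => //; [rewrite index_mem|rewrite nth_index].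
by exists c.
Qed.

(** Iterating [good_branch] grows a binary tree of good families with one index per level; the high
    position [c v] colours the node [v] with [m] colours. Along a strong subtree of constant colour
    [i], the [i]-th functional of a tuple realizes the pattern of its branch. *)
Lemma good_shattered m : good (tuples m) -> shattered.
Proof.
move=> gm; have [x0 _] : exists x : X, True by have [_ [x _]] := hi_ex 0; exists x.
pose inv j (C : seq bool -> set (seq X)) :=
  forall v, size v = j -> good (C v) /\ C v `<=` tuples m.
have step j (C : {C | inv j C}) :
    {t : nat * (seq bool -> nat) * (seq bool -> set (seq X)) | inv j.+1 t.2 /\
      forall v, size v = j -> t.1.2 v < m /\ forall b xs, t.2 (b :: v) xs ->
      sval C v xs /\ if b then t.1.2 v < size xs /\ hi (nth x0 xs (t.1.2 v)) t.1.1
                  else forall x, x \in xs -> lo x t.1.1}.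
  case: C => C iC; apply: cid => /=.
  have [|n nP] := @good_branch m _ (bitseqs j) C x0.
    by move=> v; rewrite mem_bitseqs => /eqP; exact: iC.
  have : forall v, exists c, size v = j -> c < m /\
      good [set xs | [/\ C v xs, c < size xs & hi (nth x0 xs c) n]].
    move=> v; have [vj|?] := pselect (size v = j); last by exists 0.
    have [|_ [c [? ?]]] := nP v; first by rewrite mem_bitseqs vj.
    by exists c.
  move=> /choice[c cP].
  exists (n, c, fun u => if u is b :: v then
      if b then [set xs | [/\ C v xs, c v < size xs & hi (nth x0 xs (c v)) n]]
      else [set xs | C v xs /\ forall x, x \in xs -> lo x n] else set0) => /=.
  split=> [[//|b v] [vj]|v vj]; last first.
    by split; [exact: (cP v vj).1|case=> xs /= []].
  have [_ Ct] := iC v vj; split; last first.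
    by case: b => xs /= []; [move=> /Ct|move=> /Ct].
  case: b; first exact: (cP v vj).2.
  by have [|g _] := nP v; rewrite ?mem_bitseqs ?vj.
have inv0 : inv 0 (fun=> tuples m) by move=> v _; split.
pose st := fix st j : {C | inv j C} := if j is j'.+1 then
  exist _ _ (svalP (step j' (st j'))).1 else exist _ _ inv0.
pose C u := sval (st (size u)) u.
pose n j := (sval (step j (st j))).1.1.
pose c v := (sval (step (size v) (st (size v)))).1.2 v.
have CP b v xs : C (b :: v) xs -> C v xs /\ if b
    then c v < size xs /\ hi (nth x0 xs (c v)) (n (size v))
    else forall x, x \in xs -> lo x (n (size v)).
  exact: ((svalP (step (size v) (st (size v)))).2 v erefl).2.
have Csub t v xs : C (t ++ v) xs -> C v xs.
  by elim: t => // b t IH /CP[/IH].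
have [||i [l [e [sz ce eS]]]] := @strong_subtree c (iota 0 m) [::] setT.
- exact: infinite_nat.
- move=> t _; rewrite cats0 mem_iota add0n /=.
  exact: ((svalP (step (size t) (st (size t)))).2 t erefl).1.
(* The extra leading bit [true] makes the colour [i] an index of the tuple. *)
exists m, (fun k => n (l k.+1)) => N b.
pose v := fix v k := if k is k'.+1 then b k' :: v k' else [:: true].
have sv k : size (v k) = k.+1 by elim: k => //= k ->.
have ev k j : exists t, e (v (j + k)) = t ++ e (v k).
  elim: j => [|j [t tE]]; first by exists [::].
  have [t' t'E] := eS (b (j + k)) (v (j + k)).
  by exists (rcons t' (b (j + k)) ++ t); rewrite /= t'E tE -cats1 -!catA.
have [xs Cxs] : C (e (v N)) !=set0.
  by apply: good_nonempty; exact: (svalP (st _) _ erefl).1.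
have txs : tuples m xs by apply: (svalP (st _) _ erefl).2 Cxs.
have Cv k : k <= N -> C (e (v k)) xs.
  by move=> kN; have [t] := ev k (N - k); rewrite subnK// => tE; move: Cxs;
    rewrite tE => /Csub.
have ixs : i < size xs.
  have [t tE] := eS true [::]; have := Cv 0 (leq0n _); rewrite /= tE => /Csub/CP[_].
  by rewrite ce => -[].
exists (nth x0 xs i); first by apply: txs.2; exact: mem_nth.
move=> k kN; have [t tE] := eS (b k) (v k).
have := Cv k.+1 kN; rewrite /= tE => /Csub/CP[_]; rewrite ce sz sv.
by case: (b k) => [[]//|]; apply; exact: mem_nth.
Qed.

End Blocks.

(** For selectivity, consecutive finite blocks are cut from the [B n], the k-th one large for [k].
    Without shattering no [tuples m] is good for them, and [selector_positive] yields the
    diagonal. *)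
Lemma positive_selective : ~ shattered -> selective_coideal positive_set.
Proof.
move=> nsh; split.
- exact: positive_up.
- exact: positive_part.
- exact: positive_infinite.
move=> B pB BS.
have Bdec m n : m <= n -> B n `<=` B m.
  move=> /subnK <-; elim: (n - m) => // j IH x /BS; exact: IH.
have step k N : {p : set nat * nat | [/\ finite_set p.1, large k p.1,
    forall n, p.1 n -> B N n & forall n, p.1 n -> N < n <= p.2]}.
  apply: cid; have [F [fF FB lF]] := positive_above N (pB N) k.
  have [M _ FM] := exists_ub_in infinite_nat fF.
  exists (F, M); split=> //= n Fn; have [] := FB _ Fn => // _ /= ->.
  exact/ltnW/(FM n).
pose st := fix st k := if k is k'.+1 then (sval (step k' (st k'))).2 else 0.
pose F k := (sval (step k (st k))).1.
have stF k n : F k n -> B (st k) n /\ st k < n <= st k.+1.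
  by have [_ _ ? ?] := svalP (step k (st k)) => Fn; split; auto.
have fF k : finite_set (F k) by have [] := svalP (step k (st k)).
have lF k : large k (F k) by have [] := svalP (step k (st k)).
have [m gm|phi sphi pphi] := selector_positive lF.
  by apply: nsh; exact: good_shattered gm.
exists (range phi); split => //.
  by move=> _ [k _ <-]; have [/(Bdec 0)] := stF _ _ (sphi k); auto.
have st_le k j : k < j -> phi k <= st j.
  move=> /subnK <-; elim: (j - k.+1) => [|i IH].
    by have [_ /andP[]] := stF _ _ (sphi k).
  apply: leq_trans IH _; rewrite addSn.
  have [_ /andP[h1 h2]] := stF _ _ (sphi (i + k.+1)).
  exact: leq_trans (ltnW h1) h2.
move=> _ _ [k _ <-] [j _ <-] kj.
have [kj'|jk] := ltnP k j.
  by have [/(Bdec _ _ (st_le _ _ kj'))] := stF _ _ (sphi j).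
move: jk; rewrite leq_eqVlt => /orP[/eqP jk|jk]; first by rewrite jk ltnn in kj.
have [_ /andP[h _]] := stF _ _ (sphi k).
by have := leq_trans h (ltnW kj); rewrite ltnNge st_le.
Qed.

(** Without shattering, Ramsey's theorem applies to the finite sets on which one functional of [K m]
    is high. A positive set has a finite part that no single functional covers, so the killing
    alternative holds for each [m]; [sigma] runs through the resulting decreasing sets. *)
Theorem shattered_or_null : positive_set setT ->
  shattered \/ exists sigma : nat -> nat, (forall j, j <= sigma j) /\
    forall m x, K m x -> exists n0, forall j, n0 <= j -> ~ hi x (sigma j).
Proof.
move=> pT; have [|nsh] := pselect shattered; [by left|right].
have sel := positive_selective nsh.
pose G m : set (set nat) := [set F | exists2 x, K m x & forall n, F n -> hi x n].
have step m (B : {B | positive_set B}) : {B' | positive_set B' /\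
    (B' `<=` sval B /\ kills (G m) set0 B')}.
  case: B => B pB; apply: cid => /=.
  have [B' [B'B pB' [kB'|fB']]] := coideal_ramsey sel (G m) pB.
    by exists B'.
  (* The successor admits a one-element tuple even if [m] is zero. *)
  have [F [fF FB' lF]] := pB' m.+1.
  have [x Kx hx] := fB' F fF FB'.
  have [|n Fn []] := lF [:: x].
    by split => // y; rewrite inE => /eqP ->; exact: K_mono Kx.
  by exists x; [rewrite inE|exact: hx].
pose st := fix st m : {B | positive_set B} := if m is m'.+1 then
  exist _ _ (svalP (step m' (st m'))).1 else exist _ _ pT.
pose B m := sval (st m.+1).
have Bdec m n : m <= n -> B n `<=` B m.
  move=> /subnK <-; elim: (n - m) => // j IH x Bx; apply: IH.
  exact: (svalP (step (j + m).+1 (st (j + m).+1))).2.1.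
have kB m : kills (G m) set0 (B m) by exact: (svalP (step m (st m))).2.2.
have /choice[sigma sP] : forall j, exists n, B j n /\ j <= n.
  move=> j; have pj := svalP (st j.+1).
  have [n [Bn jn]] := infinite_setN0 (positive_infinite (positive_above j pj)).
  by exists n; split => //; exact/ltnW.
exists sigma; split=> [j|m x Kx]; first by have [] := sP j.
apply: contrapT => nn0.
(* The [sigma j] with [m <= j] at which [x] is high lie in [B m]; as [j <= sigma j], infinitely many
   such [j] would give an infinite set contradicting [kB]. *)
apply: (kB m [set sigma j | j in [set j | m <= j /\ hi x (sigma j)]]).
- by move=> _ [j [mj _] <-]; apply: Bdec mj _ _; have [] := sP j.
- move=> /(exists_ub_in infinite_nat)[n _ sn]; apply: nn0; exists (maxn m n).
  move=> j; rewrite geq_max => /andP[mj nj] hj.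
  have /sn /= : [set sigma j | j in [set j | m <= j /\ hi x (sigma j)]] (sigma j).
    by exists j.
  by rewrite ltnNge (leq_trans nj)//; have [] := sP j.
- move=> F _ FM; exists x => // n /FM[//|[j [_ hj] <-]//].
Qed.

End Coverings.

(** * Seminorms and the Hahn-Banach theorem *)

Section Seminorms.
Context {R : realType} {E : lmodType R}.

Definition seminorm (p : E -> R) :=
  (forall x y, p (x + y) <= p x + p y) /\ (forall a x, p (a *: x) = `|a| * p x).

Section SeminormTheory.
Variable p : E -> R.
Hypothesis sp : seminorm p.

Lemma seminormD x y : p (x + y) <= p x + p y. Proof. by case: sp. Qed.
Lemma seminormZ a x : p (a *: x) = `|a| * p x. Proof. by case: sp. Qed.

Lemma seminorm0 : p 0 = 0.
Proof. by rewrite -(scale0r 0) seminormZ normr0 mul0r. Qed.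

Lemma seminormN x : p (- x) = p x.
Proof. by rewrite -scaleN1r seminormZ normrN1 mul1r. Qed.

Lemma seminorm_ge0 x : 0 <= p x.
Proof.
by have := seminormD x (- x); rewrite subrr seminorm0 seminormN; lra.
Qed.

Lemma seminormB x y : p (x - y) <= p x + p y.
Proof. by rewrite -(seminormN y); exact: seminormD. Qed.

Lemma seminorm_sum (I : Type) (r : seq I) (P : pred I) (F : I -> E) :
  p (\sum_(i <- r | P i) F i) <= \sum_(i <- r | P i) p (F i).
Proof.
elim/big_ind2: _ => [|x x' y y' xx' yy'|//]; first by rewrite seminorm0.
exact: le_trans (seminormD _ _) (lerD _ _).
Qed.
End SeminormTheory.

Lemma seminorm_big (I : Type) (r : seq I) (q : I -> E -> R) :
  (forall i, seminorm (q i)) -> seminorm (fun x => \sum_(i <- r) q i x).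
Proof.
move=> sq; split=> [x y|a x].
  by rewrite -big_split; apply: ler_sum => i _; exact: seminormD.
by rewrite mulr_sumr; apply: eq_bigr => i _; exact: seminormZ.
Qed.

End Seminorms.

Section HahnBanach.
Context {R : realType} {E : lmodType R}.
Variable p : E -> R.
Hypothesis sp : seminorm p.

(* Partial linear functionals dominated by [p] are represented by their graphs;
   the domination makes these automatically single-valued. *)
Let partial (G : set (E * R)) := [/\ G (0, 0),
  forall a x y, G x -> G y -> G (a *: x.1 + y.1, a * x.2 + y.2)
  & forall x, G x -> x.2 <= p x.1].

Let partial_fun G x r r' : partial G -> G (x, r) -> G (x, r') -> r = r'.
Proof.
move=> [_ linG domG] Gr Gr'; apply/eqP.
have := domG _ (linG (-1) _ _ Gr Gr'); have := domG _ (linG (-1) _ _ Gr' Gr).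
by rewrite /= scaleN1r addNr (seminorm0 sp) !mulN1r eq_le; lra.
Qed.

(** The value at [v] must lie between all [x.2 - p (x.1 - v)] and all [p (y.1 + v) - y.2]; the
    supremum of the former is taken. *)
Let partial_extend G v : partial G -> exists G', [/\ partial G', G `<=` G' &
  exists s, G' (v, s)].
Proof.
move=> [G0 linG domG].
pose A := [set x.2 - p (x.1 - v) | x in G].
have Aub x y : G x -> G y -> x.2 - p (x.1 - v) <= p (y.1 + v) - y.2.
  move=> Gx Gy; have := domG _ (linG 1 _ _ Gx Gy).
  rewrite /= scale1r mul1r => le1.
  have := seminormD sp (x.1 - v) (y.1 + v).
  by rewrite addrACA addNr addr0; lra.
have A0 : A !=set0 by exists (0 - p (0 - v)), (0, 0).
have supA : has_sup A.
  split => //; exists (p (0 + v) - 0) => _ [x Gx <-].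
  exact: (Aub x (0, 0)).
pose s := sup A.
have s1 x : G x -> x.2 - p (x.1 - v) <= s.
  by move=> Gx; apply: ub_le_sup; [exact: supA.2|exists x].
have s2 x : G x -> s <= p (x.1 + v) - x.2.
  by move=> Gx; apply: ge_sup => // _ [y Gy <-]; exact: Aub.
have linG0 a x : G x -> G (a *: x.1, a * x.2).
  by move=> Gx; have := linG a _ _ Gx G0; rewrite /= !addr0.
exists [set x | exists y t, G y /\ x = (y.1 + t *: v, y.2 + t * s)]; split.
- split.
  + by exists (0, 0), 0; rewrite /= scale0r mul0r !addr0.
  + move=> a _ _ [x [t [Gx ->]]] [y [u [Gy ->]]].
    exists (a *: x.1 + y.1, a * x.2 + y.2), (a * t + u); split; first exact: linG.
    congr pair => /=; first by rewrite scalerDr addrACA scalerA -scalerDl.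
    by ring.
  + move=> _ [[x r] [t [Gx ->]]] /=.
    have [t0|t0|->] := ltgtP t 0; last by rewrite scale0r mul0r !addr0; exact: domG Gx.
    * have /s1 /= := linG0 (- t)^-1 _ Gx.
      have -> : (- t)^-1 *: x - v = (- t)^-1 *: (x + t *: v).
        rewrite scalerDr scalerA invrN mulNr mulVf ?lt_eqF//.
        by rewrite scaleN1r.
      rewrite (seminormZ sp) gtr0_norm ?invr_gt0 ?oppr_gt0//.
      rewrite -mulrBr mulrC ler_pdivrMr ?oppr_gt0//.
      by lra.
    * have /s2 /= := linG0 t^-1 _ Gx.
      have -> : t^-1 *: x + v = t^-1 *: (x + t *: v).
        by rewrite scalerDr scalerA mulVf ?gt_eqF// scale1r.
      rewrite (seminormZ sp) gtr0_norm ?invr_gt0//.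
      rewrite -mulrBr mulrC ler_pdivlMr//.
      by lra.
- move=> [x r] Gx; exists (x, r), 0.
  by rewrite /= scale0r mul0r !addr0.
- by exists s, (0, 0), 1; rewrite /= scale1r mul1r !add0r.
Qed.

(** Stated along a map [f] so as to apply directly to lines and to copies of l1. *)
Theorem hahn_banach (F : lmodType R) (f : {linear F -> E}) (phi : {linear F -> R^o}) :
  (forall u, `|phi u| <= p (f u)) ->
  exists g : {linear E -> R^o},
    (forall u, g (f u) = phi u) /\ forall x, `|g x| <= p x.
Proof.
move=> phi_p.
pose G0 := [set (f u, phi u : R) | u in [set: F]].
have pG0 : partial G0.
  split; first by exists 0 => //; rewrite !linear0.
    by move=> a _ _ [u _ <-] [w _ <-]; exists (a *: u + w) => //; rewrite !linearP.
  by move=> _ [u _ <-] /=; exact: le_trans (ler_norm _) (phi_p u).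
pose P (G : set (E * R)) := G = set0 \/ (G0 `<=` G /\ partial G).
have [|G [PG maxG]] := @Zorn_bigcup _ P.
  move=> C CP totC; have [allC|] := pselect (forall G, C G -> G = set0).
    by left; apply/seteqP; split => // x [G /allC ->].
  move=> /existsNP[G1 /not_implyP[CG1 /eqP/set0P[x0 G1x0]]].
  have ne G x : C G -> G x -> G0 `<=` G /\ partial G.
    by move=> /CP[->|].
  have [G1sub pG1] := ne _ _ CG1 G1x0.
  right; split; first by move=> x /G1sub G1x; exists G1.
  split; first by exists G1 => //; case: pG1.
    move=> a x y [A CA Ax] [B CB By].
    have [AB|BA] := totC _ _ CA CB.
      by exists B => //; have [_ [_ + _]] := ne _ _ CB By; apply => //; exact: AB.
    by exists A => //; have [_ [_ + _]] := ne _ _ CA Ax; apply => //; exact: BA.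
  by move=> x [A CA Ax]; have [_ [_ _]] := ne _ _ CA Ax; exact.
have {PG} [G0G pG] : G0 `<=` G /\ partial G.
  case: PG => // Ge; exfalso; apply: (maxG G0); last by right; split.
  by rewrite Ge; split => // /(_ (0, 0)) h; have [/h] := pG0.
have totG v : exists r, G (v, r).
  have [G' [pG' GG' [s G's]]] := partial_extend v pG.
  exists s; apply: contrapT => nGs; apply: (maxG G'); last first.
    by right; split => //; exact: subset_trans GG'.
  by split => // /(_ _ G's).
have [g gP] := choice totG.
have lin_g : linear_for *:%R (g : E -> R^o).
  move=> a x y; apply: (partial_fun pG (gP _)).
  by have [_ + _] := pG; move=> /(_ a _ _ (gP x) (gP y)).
pose gl : {linear E -> R^o} := HB.pack (g : E -> R^o)
  (GRing.isLinear.Build R E R^o *:%R (g : E -> R^o) lin_g).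
exists gl; split=> [u|x].
  by apply: (partial_fun pG (gP _)); apply: G0G; exists u.
have domg y : g y <= p y by have [_ _ /(_ _ (gP y))] := pG.
rewrite ler_norml domg andbT lerNl.
have := domg (- x); rewrite (seminormN sp).
by have -> : g (- x) = - g x by exact: (linearN gl x).
Qed.

End HahnBanach.

(** * Minkowski functionals *)

Section Gauge.
Context {R : realType} {E : tvsType R}.

Lemma convex_setP (V : set E) : convex_set V -> forall x y t, V x -> V y ->
  0 <= t -> t <= 1 -> V (t *: x + (1 - t) *: y).
Proof.
move=> cV x y t Vx Vy t0 t1.
have := cV x y (Itv01 t0 t1) (mem_set Vx) (mem_set Vy).
by rewrite inE.
Qed.

Definition gauge (V : set E) (x : E) : R :=
  inf [set t | 0 < t /\ exists2 u, V u & x = t *: u].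

Section GaugeTheory.
Variable V : set E.
Hypotheses (V_nbhs : nbhs 0 V) (V_convex : convex_set V).
Hypothesis V_sym : forall x, V x -> V (- x).

Let V0 : V 0. Proof. exact: nbhs_singleton. Qed.

Let VZ a x : V x -> `|a| <= 1 -> V (a *: x).
Proof.
move=> Vx; have Vpos b : 0 <= b -> b <= 1 -> V (b *: x).
  by move=> b0 b1; have := convex_setP V_convex Vx V0 b0 b1; rewrite scaler0 addr0.
move=> a1; have [a0|/ltW a0] := real_leP (num_real 0) (num_real a).
  by apply: Vpos => //; rewrite -(ger0_norm a0).
rewrite -(opprK a) scaleNr; apply: V_sym; apply: Vpos; first by rewrite oppr_ge0.
by rewrite -(ler0_norm a0).
Qed.

Let absorb x : exists t, 0 < t /\ exists2 u, V u & x = t *: u.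
Proof.
have /= := @scale_continuous R E (0, x) V; rewrite scale0r => /(_ V_nbhs).
move=> [[A B] /= [/nbhs_ballP[e /= e0 eA] /nbhs_singleton Bx] AB].
exists (e / 2)^-1; split; first by rewrite invr_gt0 divr_gt0.
exists ((e / 2) *: x); last by rewrite scalerA mulVf ?scale1r// gt_eqF ?divr_gt0.
apply: (AB (e / 2, x)); split => //=; apply: eA.
by rewrite /ball /= sub0r normrN gtr0_norm ?divr_gt0// gtr_pMr// invf_lt1// ltr1n.
Qed.

Let has_inf_gauge x : has_inf [set t | 0 < t /\ exists2 u, V u & x = t *: u].
Proof. by split; [have [t ?] := absorb x; exists t|exists 0 => t [/ltW]]. Qed.

Lemma gauge_le t u : 0 < t -> V u -> gauge V (t *: u) <= t.
Proof.
move=> t0 Vu; apply: ge_inf; first by exists 0 => s [/ltW].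
by split => //; exists u.
Qed.

Lemma gauge_lt x t : gauge V x < t -> exists2 u, V u & x = t *: u.
Proof.
move=> /(inf_lt (has_inf_gauge x).1)[s [s0 [u Vu ->]] st].
have t0 := lt_trans s0 st.
exists ((s / t) *: u); last by rewrite scalerA mulrCA divff ?mulr1// gt_eqF.
by apply: VZ => //; rewrite gtr0_norm ?divr_gt0// ler_pdivrMr// mul1r ltW.
Qed.

Lemma gauge_ge0 x : 0 <= gauge V x.
Proof. by apply: lb_le_inf; [exact: (has_inf_gauge x).1|move=> t [/ltW]]. Qed.

Lemma gauge_seminorm : seminorm (gauge V).
Proof.
split=> [x y|].
  apply/ler_addgt0Pr => e e0.
  have [u Vu xu] := @gauge_lt x (gauge V x + e / 2) ltac:(lra).
  have [v Vv yv] := @gauge_lt y (gauge V y + e / 2) ltac:(lra).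
  set s := gauge V x + e / 2 in xu; set t := gauge V y + e / 2 in yv.
  have s0 : 0 < s by rewrite /s; have := gauge_ge0 x; lra.
  have t0 : 0 < t by rewrite /t; have := gauge_ge0 y; lra.
  have st0 : 0 < s + t by lra.
  have -> : x + y = (s + t) *: ((s / (s + t)) *: u + (1 - s / (s + t)) *: v).
    rewrite scalerDr !scalerA xu yv; congr (_ *: _ + _ *: _); field.
      by rewrite gt_eqF.
    by rewrite gt_eqF.
  apply: le_trans (gauge_le st0 _) _; last by rewrite /s /t; lra.
  apply: convex_setP => //; first by rewrite divr_ge0// ltW.
  by rewrite ler_pdivrMr// mul1r; lra.
(* The converse inequality is this one for the inverse of [a]. *)
have le1 a x : a != 0 -> gauge V (a *: x) <= `|a| * gauge V x.
  move=> a0; have na0 : 0 < `|a| by rewrite normr_gt0.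
  rewrite mulrC -ler_pdivrMr//; apply/ler_addgt0Pr => e e0.
  have [u Vu xu] := @gauge_lt x (gauge V x + e) ltac:(lra).
  rewrite ler_pdivrMr//.
  have t0 : 0 < gauge V x + e by have := gauge_ge0 x; lra.
  have -> : a *: x = ((gauge V x + e) * `|a|) *: ((a / `|a|) *: u).
    by rewrite {1}xu !scalerA; congr (_ *: _); field; rewrite gt_eqF.
  apply: gauge_le; first exact: mulr_gt0.
  by apply: VZ => //; rewrite normrM normfV normr_id divff// gt_eqF.
move=> a x; have [->|a0] := eqVneq a 0.
  rewrite scale0r normr0 mul0r; apply/eqP; rewrite eq_le gauge_ge0 andbT.
  apply/ler_addgt0Pr => e e0; rewrite add0r -(scaler0 E e).
  exact: gauge_le.
apply/eqP; rewrite eq_le le1//=.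
have := @le1 a^-1 (a *: x); rewrite invr_eq0 => /(_ a0).
rewrite scalerA mulVf// scale1r normfV mulrC ler_pdivlMr ?normr_gt0//.
by rewrite mulrC.
Qed.

End GaugeTheory.
End Gauge.

(** * Generating seminorms of a Frechet space *)

Section FrechetSeminorms.
Context {R : realType} {E : tvsType R}.

Lemma convex_nbhs0 (U : set E) : nbhs 0 U -> exists V, [/\ nbhs 0 V,
  convex_set V, forall x, V x -> V (- x) & V `<=` U].
Proof.
move=> U0; have [B Bconv [Bop Bnbhs]] := @locally_convex R E.
have [W [BW W0] WU] := Bnbhs 0 U U0.
have nW : nbhs 0 W by apply: open_nbhs_nbhs; split => //; exact: Bop.
have cW := convex_setP (Bconv W (mem_set BW)).
exists (W `&` [set x | W (- x)]); split.
- apply: filterI => //; have := @opp_continuous E 0; rewrite /continuous_at oppr0.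
  exact.
- move=> x y l; rewrite !inE => -[Wx Wx'] [Wy Wy'].
  split; first by apply: cW.
  by rewrite /= opprD -!scalerN; apply: cW.
- by move=> x [Wx Wx'] /=; rewrite opprK.
- by move=> x [/WU].
Qed.

Definition generating (p : nat -> E -> R) :=
  [/\ forall k, seminorm (p k), forall k x, p k x <= p k.+1 x
    & forall U : set E,
        nbhs 0 U <-> exists k e, 0 < e /\ [set x | p k x < e] `<=` U].

(** Gauges of convex symmetric neighbourhoods inside the balls of radius 1/(n+1), summed to obtain
    an increasing sequence. *)
Lemma frechet_seminorms : frechet E -> exists p, generating p.
Proof.
move=> [[d [d0 dE dsym dtri dnbhs]] _].
have /choice[V VP] : forall n, exists V : set E, [/\ nbhs 0 V, convex_set V,
    forall x, V x -> V (- x) & V `<=` [set y | d 0 y < n.+1%:R^-1]].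
  move=> n; apply: convex_nbhs0; rewrite dnbhs.
  by exists n.+1%:R^-1; rewrite /= ?invr_gt0.
have sg n : seminorm (gauge (V n)) by have [? ? ? _] := VP n; exact: gauge_seminorm.
pose p k x := \sum_(i <- iota 0 k.+1) gauge (V i) x.
have sp k : seminorm (p k) by exact: seminorm_big.
have ple k j x : (j <= k)%N -> gauge (V j) x <= p k x.
  move=> jk; rewrite /p (bigD1_seq j) ?iota_uniq ?mem_iota//=.
  by rewrite lerDl sumr_ge0// => i _; exact: seminorm_ge0.
exists p; split => //.
  move=> k x; rewrite /p -(addn1 k.+1) iotaD big_cat/= big_seq1.
  by rewrite lerDl; exact: seminorm_ge0.
move=> U; split=> [|[k [e [e0 pU]]]].
  rewrite dnbhs => -[e /= e0 eU].
  have [n ne] : exists n, n.+1%:R^-1 < e.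
    exists (Num.truncn e^-1); rewrite invf_plt ?posrE//.
    exact: truncnS_gt.
  exists n, 1; split => // x px; apply: eU => /=; apply: lt_trans ne.
  have [nV cV sV Vd] := VP n; apply: Vd.
  have [|u Vu ->] := @gauge_lt _ _ (V n) nV cV sV x 1; last by rewrite scale1r.
  exact: le_lt_trans (ple _ _ _ (leqnn n)) px.
apply: filterS pU _; rewrite /p; elim: (iota 0 k.+1) e e0 => [|i r IH] e e0.
  by apply: filterS filterT => x _ /=; rewrite big_nil.
have [nV _ _ _] := VP i; have e2 : 0 < e / 2 / 2 by rewrite !divr_gt0.
have e4 : 0 < e / 2 by rewrite divr_gt0.
apply: filterS2 (IH _ e4) (nbhs0Z (lt0r_neq0 e2) nV) => x /= xr [u Vu xu].
rewrite big_cons -xu; have := gauge_le e2 Vu; rewrite -xu in xr *.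
lra.
Qed.
End FrechetSeminorms.

(** * The dual of a Frechet space *)

Section Generating.
Context {R : realType} {E : tvsType R}.
Variable p : nat -> E -> R.
Hypothesis gp : generating p.

Lemma gen_seminorm k : seminorm (p k). Proof. by case: gp. Qed.
#[local] Hint Resolve gen_seminorm : core.

Lemma gen_le k n x : (k <= n)%N -> p k x <= p n x.
Proof.
have [_ le_p _] := gp; move=> /subnK <-; elim: (n - k)%N => // j IH.
exact: le_trans IH (le_p _ _).
Qed.

Lemma gen_nbhsP x U :
  nbhs x U <-> exists k e, 0 < e /\ [set y | p k (y - x) < e] `<=` U.
Proof.
have [_ _ nbhs0P] := gp; split=> [xU|[k [e [e0 eU]]]].
  have : nbhs 0 [set z | U (x + z)].
    have /= := @add_continuous E (x, 0) U; rewrite addr0 => /(_ xU).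
    move=> [[A B] /= [/nbhs_singleton Ax B0] AB].
    by apply: filterS B0 => z Bz; apply: (AB (x, z)).
  move=> /nbhs0P[k [e [e0 eU]]]; exists k, e; split => // y ye.
  by rewrite -(subrK x y) addrC; exact: eU.
have : nbhs 0 [set z : E | p k z < e] by apply/nbhs0P; exists k, e; split.
move=> /(nbhsT x); apply: filterS => _ [z /= ze <-].
by apply: eU => /=; rewrite addrAC subrr add0r.
Qed.

Lemma gen_eq0 : @metrizable R E -> forall x, (forall k, p k x = 0) -> x = 0.
Proof.
move=> [d [d0 dE _ _ dnbhs]] x px; apply/esym/dE/eqP.
rewrite eq_le d0 andbT; apply/ler_addgt0Pr => e e0; rewrite add0r ltW//.
have : nbhs 0 [set y | d 0 y < e] by rewrite dnbhs; exists e.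
by move=> /gen_nbhsP[k [e' [e'0]]]; apply; rewrite /= subr0 px.
Qed.

Lemma gen_linear_continuous (h : {linear E -> R^o}) :
  continuous (h : E -> R^o) <-> exists k C, forall x, `|h x| <= C * p k x.
Proof.
split=> [ch|[k [C hC]] x].
  have : nbhs (0 : E) [set x | `|h x| < 1].
    have /= := ch 0; rewrite /continuous_at linear0.
    move=> /cvgrPdist_lt/(_ 1 ltr01); apply: filterS => x.
    by rewrite /= sub0r normrN.
  move=> /gen_nbhsP[k [e [e0 eh]]]; exists k, e^-1 => x.
  rewrite mulrC ler_pdivlMr//; apply/ler_addgt0Pr => r r0.
  have p0 := seminorm_ge0 (gen_seminorm k) x.
  have pr : 0 < p k x + r by rewrite ltr_wpDl.
  (* The slack [r] keeps the denominator positive when [p k x = 0]. *)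
  pose t := e / (p k x + r); have t0 : 0 < t by exact: divr_gt0.
  have pt : p k (t *: x - 0) < e.
    rewrite subr0 seminormZ// gtr0_norm// mulrAC ltr_pdivrMr// ltr_pM2l//.
    by rewrite ltrDl.
  have := eh _ pt; rewrite /= linearZ /= normrZ gtr0_norm//.
  by rewrite mulrAC ltr_pdivrMr// mul1r mulrC => /ltW.
apply/cvgrPdist_lt => e e0; apply/gen_nbhsP.
have C1 : 0 < `|C| + 1 by rewrite ltr_wpDl.
exists k, (e / (`|C| + 1)); split; first exact: divr_gt0.
move=> y /=; rewrite ltr_pdivlMr// => ye.
rewrite distrC -linearB; apply: le_lt_trans (hC _) _; apply: le_lt_trans ye.
rewrite mulrC ler_wpM2l ?seminorm_ge0//.
by apply: le_trans (ler_norm C) _; rewrite lerDl.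
Qed.

Lemma gen_bounded (A : set E) :
  tvs_bounded A <-> forall k, exists M, forall a, A a -> p k a <= M.
Proof.
split=> [bA k|bA U /gen_nbhsP[k [e [e0 eU]]]].
  have : nbhs 0 [set x | p k x < 1].
    by apply/gen_nbhsP; exists k, 1; split => // x /=; rewrite subr0.
  move=> /bA[M [_ MA]]; pose t := Num.max (M + 1) 1.
  have t0 : 0 < t by rewrite /t lt_max ltr01 orbT.
  have := MA t; rewrite /t lt_max ltrDl ltr01 => /(_ isT) AU.
  exists t => a /AU[u /= u1 <-].
  by rewrite seminormZ// gtr0_norm// ger_pMr// ltW.
have [M MA] := bA k; pose M' := `|M| + 1.
have M'0 : 0 < M' by rewrite ltr_wpDl.
exists (M' / e); split; first by rewrite num_real.
move=> t tM a Aa; have t0 : 0 < t by apply: lt_trans tM; exact: divr_gt0.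
exists (t^-1 *: a); last by rewrite scalerA divff ?scale1r// gt_eqF.
apply: eU; rewrite /= subr0 seminormZ// gtr0_norm ?invr_gt0//.
rewrite mulrC ltr_pdivrMr//; apply: le_lt_trans (MA _ Aa) _.
have : M < M' by rewrite /M'; have := ler_norm M; lra.
by move=> /lt_trans; apply; rewrite mulrC -ltr_pdivrMr.
Qed.

Definition gen_cvg (s : nat -> E) x := forall k e, 0 < e ->
  exists N, forall n, (N <= n)%N -> p k (s n - x) < e.

Lemma gen_complete (s : nat -> E) : tvs_complete E ->
  (forall k e, 0 < e -> exists N, forall m n, (N <= m)%N -> (N <= n)%N ->
     p k (s m - s n) < e) -> exists x, gen_cvg s x.
Proof.
move=> cE cs; have [|x sx] := cE (s @ \oo) _.
  move=> U /gen_nbhsP[k [e [e0 eU]]].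
  have [N NP] := cs k e e0.
  exists (s @` [set n | (N <= n)%N], s @` [set n | (N <= n)%N]).
    by split; exists N => // n Nn; exists n.
  by move=> [_ _] /= [[m Nm <-] [n Nn <-]]; apply: eU; rewrite /= subr0; exact: NP.
exists x => k e e0; have : nbhs x [set y | p k (y - x) < e].
  by apply/gen_nbhsP; exists k, e; split.
by move=> /sx[N _ NP]; exists N.
Qed.

Lemma gen_cvg_unique : @metrizable R E -> forall s x y,
  gen_cvg s x -> gen_cvg s y -> x = y.
Proof.
move=> mE s x y sx sy; apply/eqP; rewrite -subr_eq0; apply/eqP/gen_eq0 => // k.
apply/eqP; rewrite eq_le seminorm_ge0// andbT; apply/ler_addgt0Pr => e e0.
have e2 : 0 < e / 2 by rewrite divr_gt0.
have [N NP] := sx k _ e2; have [M MP] := sy k _ e2.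
have := NP (maxn N M) (leq_maxl _ _); have := MP (maxn N M) (leq_maxr _ _).
set z := s _; move=> zy zx; have -> : x - y = (z - y) - (z - x).
  by rewrite opprB [RHS]addrC addrA subrK.
by have := seminormB (gen_seminorm k) (z - y) (z - x); lra.
Qed.

(* The polars of the balls of [p m], scaled so that they exhaust the dual. *)
Definition polar m : set (E -> R) :=
  [set h | (forall a x y, h (a *: x + y) = a * h x + h y) /\
           forall x, `|h x| <= m%:R * p m x].

Lemma polar_lin m h : polar m h ->
  exists2 g : {linear E -> R^o}, (g : E -> R) = h & continuous (g : E -> R^o).
Proof.
move=> [lh hm].
pose g : {linear E -> R^o} := HB.pack (h : E -> R^o)
  (GRing.isLinear.Build R E R^o *:%R (h : E -> R^o) lh).
by exists g => //; apply/gen_linear_continuous; exists m, m%:R.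
Qed.

Lemma polar_mono m n : (m <= n)%N -> polar m `<=` polar n.
Proof.
move=> mn h [lh hm]; split => // x; apply: le_trans (hm x) _.
by apply: ler_pM; rewrite ?ler0n ?seminorm_ge0 ?ler_nat ?gen_le.
Qed.

(** One integer serves both as index of the seminorm and as constant, hence the maximum. *)
Lemma linear_polar (h : {linear E -> R^o}) k C :
  (forall x, `|h x| <= C * p k x) -> exists m, polar m (h : E -> R).
Proof.
move=> hC; exists (maxn k (Num.truncn C).+1); split=> [a x y|x].
  exact: linearP.
apply: le_trans (hC x) _; apply: (@le_trans _ _ ((maxn k (Num.truncn C).+1)%:R * p k x)).
  apply: ler_wpM2r; first exact: seminorm_ge0.
  apply/ltW/(lt_le_trans (truncnS_gt C)); rewrite ler_nat; exact: leq_maxr.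
by apply: ler_wpM2l => //; apply: gen_le; exact: leq_maxl.
Qed.

Lemma continuous_polar (h : {linear E -> R^o}) :
  continuous (h : E -> R^o) -> exists m, polar m (h : E -> R).
Proof. by move=> /gen_linear_continuous[k [C]]; exact: linear_polar. Qed.

(** Hahn-Banach on the line through [x], for a seminorm normalized to 1 at [x]. *)
Lemma polar_separates x : @metrizable R E -> x != 0 ->
  exists m h, polar m h /\ 1 <= h x.
Proof.
move=> mE x0; have [k pk] : exists k, 0 < p k x.
  apply: contrapT => npk; move/eqP: x0; apply; apply: gen_eq0 => // k.
  apply/eqP; rewrite eq_le seminorm_ge0// andbT leNgt.
  by apply/negP => pk; apply: npk; exists k.
pose q y := (p k x)^-1 * p k y.
have sq : seminorm q.
  split=> [y z|a y]; rewrite /q; last by rewrite seminormZ// mulrCA.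
  by rewrite -mulrDr ler_wpM2l ?invr_ge0 ?seminorm_ge0// seminormD.
have lf : linear_for *:%R (fun a : R^o => a *: x).
  by move=> a b c; rewrite scalerDl scalerA.
pose f : {linear R^o -> E} := HB.pack (fun a : R^o => a *: x)
  (GRing.isLinear.Build R R^o E *:%R (fun a : R^o => a *: x) lf).
have [|g [gf gq]] := @hahn_banach R E q sq R^o f idfun.
  by move=> a; rewrite /q seminormZ//= mulrCA mulVf ?gt_eqF// mulr1.
have [m hm] := linear_polar (k := k) (C := (p k x)^-1) gq.
exists m, g; split => //.
by have := gf 1; rewrite /= scale1r => ->.
Qed.
End Generating.

(** * Embedding of l1 *)

Section Ell1.
Context {R : realType}.

Local Notation psum u n := (\sum_(0 <= i < n) `|u i|).

Lemma ell1_psum_le (u : ell1 R) n : psum u n <= ell1_norm u.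
Proof.
apply: (nondecreasing_cvgn_le (u_ := series (fun i => `|u i|)));
  last exact: ell1_cvg.
by apply: nondecreasing_series => i _ _.
Qed.

Lemma ell1_norm_le (u : ell1 R) M : (forall n, psum u n <= M) -> ell1_norm u <= M.
Proof.
move=> uM; apply: limr_le; first exact: ell1_cvg.
by apply: nearW => n; exact: uM.
Qed.

Lemma ell1_psum_gt (u : ell1 R) e : 0 < e ->
  exists N, forall n, (N <= n)%N -> ell1_norm u - e < psum u n.
Proof.
move=> e0; have /cvgrPdist_lt/(_ e e0)[N _ NP] := @ell1_cvg R u.
exists N => n /NP /=; rewrite -/(ell1_norm u) ltr_distlC => /andP[+ _].
by rewrite ltrBlDr /series/=; lra.
Qed.

Lemma ell1_pred_bounded (u : nat -> R) M :
  (forall n, psum u n <= M) -> u \in ell1_pred.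
Proof.
move=> uM; rewrite inE /=; apply: nondecreasing_is_cvgn.
  by apply: nondecreasing_series => i _ _.
by exists M => _ [n _ <-]; exact: uM.
Qed.

Lemma ell1_normE (u : ell1 R) : `|u| = ell1_norm u. Proof. by []. Qed.

End Ell1.

Section Ell1Embedding.
Context {R : realType} {E : tvsType R}.
Variables (p : nat -> E -> R) (e : nat -> E).
Hypotheses (gp : generating p) (hE : frechet E).
Hypothesis e_bounded : forall k, exists M, forall n, p k (e n) <= M.

Let S (u : nat -> R) N := \sum_(0 <= i < N) u i *: e i.

Let S_diff u k M m n : (forall n, p k (e n) <= M) -> (n <= m)%N ->
  p k (S u m - S u n) <= M * (\sum_(0 <= i < m) `|u i| - \sum_(0 <= i < n) `|u i|).
Proof.
move=> MP nm; rewrite /S (big_cat_nat (leq0n n) nm)//= addrAC subrr add0r.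
rewrite [in leRHS](big_cat_nat (leq0n n) nm)//= addrAC subrr add0r mulr_sumr.
apply: le_trans (seminorm_sum (gen_seminorm gp k) _ _ _) _.
apply: ler_sum => i _; rewrite (seminormZ (gen_seminorm gp k)) mulrC.
by apply: ler_wpM2r.
Qed.

Let S_cvg (u : ell1 R) : exists x, gen_cvg p (S u) x.
Proof.
have [_ cE] := hE; apply: (gen_complete gp) => // k d d0.
have [M MP] := e_bounded k.
have M0 : 0 <= M by apply: le_trans (MP 0%N); exact: seminorm_ge0 (gen_seminorm gp k) _.
have M1 : 0 < M + 1 by rewrite ltr_wpDl.
have [N NP] := ell1_psum_gt u (divr_gt0 d0 M1).
exists N; wlog : / forall m n, (N <= m)%N -> (N <= n)%N -> (n <= m)%N ->
    p k (S u m - S u n) < d.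
  apply=> m n Nm Nn nm; apply: le_lt_trans (S_diff u MP nm) _.
  have := NP n Nn; have := ell1_psum_le u m.
  set a := bigop.body _ _ _; set b := bigop.body _ _ _ => am bn.
  have : (a - b) * (M + 1) < d by rewrite -ltr_pdivlMr//; lra.
  have [ab|ab] := leP 0 (a - b); first by nra.
  by move=> _; apply: le_lt_trans d0; rewrite mulr_ge0_le0// ltW.
move=> key m n Nm Nn; have [nm|/ltnW mn] := leqP n m; first exact: key.
by rewrite -(seminormN (gen_seminorm gp k)) opprB; exact: key.
Qed.

Let T (u : ell1 R) := sval (cid (S_cvg u)).

Let T_cvg (u : ell1 R) : gen_cvg p (S u) (T u). Proof. exact: svalP. Qed.

Let gen_cvg_le k s x r : gen_cvg p s x -> (forall n, p k (s n) <= r) -> p k x <= r.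
Proof.
move=> sx sr; apply/ler_addgt0Pr => d d0; have [N NP] := sx k d d0.
have := seminormB (gen_seminorm gp k) (s N) (s N - x).
by rewrite opprB addrC subrK; have := NP N (leqnn N); have := sr N; lra.
Qed.

Let T_linear a (u v : ell1 R) : T (a *: u + v) = a *: T u + T v.
Proof.
have [mE _] := hE.
apply: (gen_cvg_unique gp mE (T_cvg _)) => k d d0.
have c0 : 0 < d / 2 / (`|a| + 1) by rewrite !divr_gt0// ltr_wpDl.
have [N NP] := T_cvg u k c0.
have [M MP] := T_cvg v k (divr_gt0 d0 (ltr0Sn _ 1)).
exists (maxn N M) => n; rewrite geq_max => /andP[Nn Mn].
have -> : S (a *: u + v : ell1 R) n - (a *: T u + T v) =
    a *: (S u n - T u) + (S v n - T v).
  rewrite scalerBr addrACA -opprD; congr (_ - _).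
  rewrite /S scaler_sumr -big_split; apply: eq_bigr => i _ /=.
  by rewrite scalerA -scalerDl.
apply: le_lt_trans (seminormD (gen_seminorm gp k) _ _) _.
rewrite (seminormZ (gen_seminorm gp k)); have := MP n Mn.
have a1 : 0 < `|a| + 1 by rewrite ltr_wpDl.
have := NP n Nn; rewrite ltr_pdivlMr//.
have := seminorm_ge0 (gen_seminorm gp k) (S u n - T u).
set x := p k (S u n - T u); set y := p k (S v n - T v); nra.
Qed.

Let T_le k M (u : ell1 R) : (forall n, p k (e n) <= M) -> p k (T u) <= M * `|u|.
Proof.
move=> MP; apply: gen_cvg_le (T_cvg u) _ => n.
have := S_diff u MP (leq0n n); rewrite /S !(big_geq (leqnn 0)) !subr0 => /le_trans; apply.
have M0 : 0 <= M by apply: le_trans (MP 0%N); exact: seminorm_ge0 (gen_seminorm gp k) _.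
by apply: ler_wpM2l => //; exact: ell1_psum_le.
Qed.

(** The series of the [u i *: e i] converges to [T u] by boundedness of [e] and completeness of [E];
    the lower estimate passes to the limit and makes the inverse of [T] continuous on its range. *)
Theorem ell1_embedding m c : 0 < c ->
  (forall N (a : nat -> R), c * \sum_(0 <= i < N) `|a i| <=
     p m (\sum_(0 <= i < N) a i *: e i)) ->
  exists L : set E, isomorphic_copy (ell1 R) L.
Proof.
move=> c0 lower.
have T_ge u : `|u| <= c^-1 * p m (T u).
  apply: ell1_norm_le => n; rewrite ler_pdivlMl//; apply/ler_addgt0Pr => d d0.
  have [N NP] := T_cvg u m d0.
  have := NP _ (leq_maxl N n); have := lower (maxn N n) u.
  have : \sum_(0 <= i < n) `|u i| <= \sum_(0 <= i < maxn N n) `|u i|.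
    by rewrite (big_cat_nat (leq0n n) (leq_maxr N n))//= lerDl sumr_ge0.
  rewrite -/(S u _) => le1 le2 lt3.
  have := seminormD (gen_seminorm gp m) (S u (maxn N n) - T u) (T u).
  rewrite subrK; have : c * \sum_(0 <= i < n) `|u i| <=
    c * \sum_(0 <= i < maxn N n) `|u i| by rewrite ler_pM2l.
  by lra.
pose f : {linear ell1 R -> E} := HB.pack T
  (GRing.isLinear.Build R (ell1 R) E *:%R T T_linear).
have f_inj : injective f.
  move=> u v uv; apply/eqP; rewrite -subr_eq0 -normr_le0.
  apply: le_trans (T_ge _) _; have -> : T (u - v) = f u - f v by exact: (linearB f).
  by rewrite uv subrr (seminorm0 (gen_seminorm gp m)) mulr0.
pose g y := if pselect (exists u, f u = y) is left h then sval (cid h) else 0.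
have fK : cancel f g.
  move=> u; rewrite /g; case: pselect => [h|[]]; last by exists u.
  exact: (f_inj _ _ (svalP (cid h))).
have gK : {in range f, cancel g f}.
  by move=> _ /set_mem[u _ <-]; rewrite fK.
exists (range f); split.
  split; first by rewrite inE; exists 0 => //; rewrite linear0.
  move=> a _ _ /set_mem[u _ <-] /set_mem[v _ <-]; rewrite inE.
  by exists (a *: u + v) => //; rewrite linearP.
exists f, g; split => //.
- move=> u U /(gen_nbhsP gp)[k [d [d0 dU]]].
  have [M MP] := e_bounded k; have M0 : 0 < `|M| + 1 by rewrite ltr_wpDl.
  suff : nbhs (u : ell1 R) [set v : ell1 R | U (f v)] by [].
  apply/(@nbhs_ballP R (ell1 R)); exists (d / (`|M| + 1)); first exact: divr_gt0.
  move=> v; rewrite -ball_normE /=; rewrite distrC ltr_pdivlMr// => vd; apply: dU => /=.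
  have -> : T v - T u = T (v - u) by exact/esym/(linearB f).
  apply: le_lt_trans (T_le _ MP) _; apply: le_lt_trans vd.
  rewrite mulrC ler_wpM2l//; have := ler_norm M; lra.
- apply/subspace_continuousP => _ [u _ <-]; rewrite /from_subspace fK => U /(@nbhs_ballP R (ell1 R))[d /= d0 dU].
  rewrite /within /=; apply/(gen_nbhsP gp); exists m, (d * c).
  split; first exact: mulr_gt0.
  move=> y /= vd [v _ vy]; rewrite -vy /= in vd *; rewrite /preimage /= fK.
  apply: dU; rewrite -ball_normE /=.
  rewrite distrC; apply: le_lt_trans (T_ge _) _.
  have -> : T (v - u) = f v - f u by exact: (linearB f).
  by rewrite mulrC ltr_pdivrMr.
Qed.
End Ell1Embedding.

(** * Weakly null sequences *)

Section UltraLimits.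
Context {R : realType}.

Lemma ultra_bounded_cvg (T : Type) (U : set_system T) (v : T -> R) (M : R) :
  UltraFilter U -> (forall t, `|v t| <= M) -> exists l : R, v @ U --> l.
Proof.
move=> UU vM; have [|l [_ cl]] := @segment_compact R (- M) M (v @ U) _.
  suff : U [set t | (`[- M, M]%classic : set R) (v t)] by [].
  by apply: filterS filterT => t _; have := vM t; rewrite ler_norml /= in_itv.
exists l => W lW; have [//|nW] := in_ultra_setVsetC (v @^-1` W) UU.
by have [x [nWx Wx]] := cl (~` W) W nW lW.
Qed.

End UltraLimits.

Section WeakNull.
Context {R : realType} {E : tvsType R}.
Variables (p : nat -> E -> R).
Hypotheses (gp : generating p) (hE : frechet E).

Lemma polarZ m c h : polar p m h -> exists n, polar p n (fun x => c * h x).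
Proof.
move=> [lh hm].
have lch : linear_for *:%R ((fun x => c * h x) : E -> R^o).
  by move=> a x y; rewrite lh mulrDr mulrCA.
pose g : {linear E -> R^o} := HB.pack ((fun x => c * h x) : E -> R^o)
  (GRing.isLinear.Build R E R^o *:%R ((fun x => c * h x) : E -> R^o) lch).
apply: (linear_polar gp (h := g) (k := m) (C := `|c| * m%:R)) => x.
by rewrite /= normrM -mulrA ler_wpM2l.
Qed.

(* Alaoglu's theorem, in the form of a compactness argument for [polar p k]. *)
Lemma polar_compact (D : set E) k :
  (forall hs : seq (E -> R), (forall h, h \in hs -> polar p k h) ->
     exists2 x, D x & forall h, h \in hs -> h x < 1) ->
  exists2 F : seq E, (forall x, x \in F -> D x) &
    forall hs : seq (E -> R), (size hs <= k)%N ->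
      (forall h, h \in hs -> polar p k h) ->
      exists2 x, x \in F & forall h, h \in hs -> h x < 1.
Proof.
move=> Dclos; apply: contrapT => noF.
have wit (F : seq E) : exists hs : nat -> E -> R, (forall x, x \in F -> D x) ->
    (forall i, polar p k (hs i)) /\
    forall x, x \in F -> exists2 i, (i < k)%N & 1 <= hs i x.
  have [FD|] := pselect (forall x, x \in F -> D x); last by exists (fun=> fun=> 0).
  apply: contrapT => nhs; apply: noF; exists F => // hs shs Khs.
  apply: contrapT => nx; apply: nhs; exists (nth (fun=> 0) hs) => _; split.
    move=> i; have [ik|ki] := ltnP i (size hs); first by apply: Khs; exact: mem_nth.
    rewrite nth_default//; split=> [a x y|x]; first by rewrite mulr0 addr0.
    by rewrite normr0 mulr_ge0// seminorm_ge0//; exact: gen_seminorm.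
  move=> x xF; apply: contrapT => ni; apply: nx; exists x => // h hhs.
  rewrite ltNge; apply/negP => hx; apply: ni; exists (index h hs).
    by rewrite (leq_trans _ shs)// index_mem.
  by rewrite nth_index.
have [w wP] := choice wit.
pose B := [set F : seq E | forall x, x \in F -> D x].
(* An ultrafilter on the finite subsets of [D], finer than inclusion, provides limits of the
   covering functionals. *)
pose Phi : set_system (seq E) := filter_from B
  (fun F0 => [set F | B F /\ {subset F0 <= F}]).
have PhiF : ProperFilter Phi.
  apply: filter_from_proper; last by move=> F BF; exists F; split.
  apply: filter_from_filter; first by exists [::].
  move=> F1 F2 B1 B2; exists (F1 ++ F2).
    by move=> x; rewrite mem_cat => /orP[/B1|/B2].
  by move=> F [BF sF]; split; split=> // x xF; apply: sF; rewrite mem_cat xF ?orbT.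
have [U [UU PhiU]] := ultraFilterLemma PhiF.
have PhiB : Phi B by exists [::] => // F [].
pose v F i x := if pselect (B F) then w F i x else 0.
have v_lin F i a x y : v F i (a *: x + y) = a * v F i x + v F i y.
  rewrite /v; case: pselect => [BF|?] /=; last by rewrite mulr0 addr0.
  by have [/(_ i)[+ _] _] := wP F BF; apply.
have v_le F i x : `|v F i x| <= k%:R * p k x.
  rewrite /v; case: pselect => [BF|?] /=; first by have [/(_ i)[_]] := wP F BF.
  by rewrite normr0 mulr_ge0// seminorm_ge0//; exact: gen_seminorm.
have /choice[H HP] : forall ix : nat * E, exists l : R,
    v F ix.1 ix.2 @[F --> U] --> l.
  by move=> [i x]; exact: ultra_bounded_cvg.
have KH i : polar p k (fun x => H (i, x)).
  split=> [a x y|x].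
    apply: (cvg_unique _ (HP (i, a *: x + y))) => //=.
    under eq_fun do rewrite v_lin.
    by apply: cvgD; [apply: cvgMr; exact: (HP (i, x))|exact: (HP (i, y))].
  have Hn := cvg_norm (HP (i, x)).
  by apply: (cvgr_to_le (Hn _)); apply: nearW => F /=.
(* The [k] limits stay in [polar p k], so they all miss some [x] of [D]. For almost all [F], which
   contain [x], the functionals attached to [F] then miss [x] too. *)
have [|x Dx Hx] := Dclos [seq (fun x => H (nat_of_ord i, x)) | i <- enum 'I_k].
  by move=> h /mapP[i _ ->].
have UHx : U [set F | forall i : 'I_k, v F i x < 1].
  apply: filter_forall => i.
  have : H (nat_of_ord i, x) < 1.
    by apply: (Hx (fun y => H (nat_of_ord i, y))); apply/mapP; exists i => //; rewrite mem_enum.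
  exact: (cvgr_lt _ (HP (nat_of_ord i, x))).
have UxB : U [set F | B F /\ x \in F].
  apply: PhiU; exists [:: x]; first by move=> y; rewrite inE => /eqP ->.
  by move=> F [BF sF]; split => //; apply: sF; rewrite inE.
have [F [[BF xF] Fi]] := filter_ex (filterI UxB UHx).
have [_ /(_ x xF)[i ik]] := wP F BF.
have /= := Fi (Ordinal ik); rewrite /v; case: pselect => //= ?.
by rewrite ltNge => /negP.
Qed.

(** The third hypothesis places 0 in the weak closure of [D]. By [polar_compact] countably many
    points of [D] make the whole index set positive, and [shattered_or_null] applies to them. *)
Theorem ell1_or_weak_null (D : set E) :
  (forall k, exists M, forall x, D x -> p k x <= M) -> ~ D 0 ->
  (forall k (hs : seq (E -> R)), (forall h, h \in hs -> polar p k h) ->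
     exists2 x, D x & forall h, h \in hs -> h x < 1) ->
  (exists L : set E, isomorphic_copy (ell1 R) L) \/
  exists2 y : nat -> E, (forall n, D (y n)) &
    forall m h, polar p m h -> h (y n) @[n --> \oo] --> (0 : R).
Proof.
move=> Dbnd D0 Dclos.
have [x0 Dx0 _] := Dclos 0%N [::] ltac:(done).
have /choice[F FP] : forall k, exists F : seq E, (forall x, x \in F -> D x) /\
    forall hs : seq (E -> R), (size hs <= k)%N ->
      (forall h, h \in hs -> polar p k h) ->
      exists2 x, x \in F & forall h, h \in hs -> h x < 1.
  by move=> k; have [F] := polar_compact (Dclos k); exists F.
(* The j-th point of [F i] is listed at the code of (i, j); [x0] fills the other indices. *)
pose d n : E := if unpickle n is Some (i, j) then nth x0 (F i) j else x0.
have dD n : D (d n).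
  rewrite /d; case: unpickle => [[i j]|//].
  have [jF|Fj] := ltnP j (size (F i)); last by rewrite nth_default.
  by apply: (FP i).1; exact: mem_nth.
pose hi (h : E -> R) n := 1 <= h (d n).
pose lo (h : E -> R) n := h (d n) <= 2^-1.
pose dbl (h : E -> R) x := 2 * h x.
have Kdbl m h : polar p m h -> polar p (m + m) (dbl h).
  move=> [lh hm]; split=> [a x y|x]; first by rewrite /dbl lh; ring.
  rewrite /dbl normrM ger0_norm// natrD.
  have := gen_le gp x (leq_addr m m); have := hm x; have : 0 <= m%:R :> R by [].
  by set a := p m x; set b := p (m + m) x; nra.
have lodbl h n : ~ hi (dbl h) n -> lo h n.
  by move/negP; rewrite /hi /lo /dbl -ltNge => ?; lra.
have hi_ex n : exists m h, polar p m h /\ hi h n.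
  have [mE _] := hE; apply: polar_separates => //.
  by apply/eqP => dn0; apply: D0; rewrite -dn0.
have [|[m [g sh]]|[s [sge sP]]] := shattered_or_null (polar_mono gp) Kdbl lodbl hi_ex.
- move=> m; exists [set pickle (m, j) | j in `I_(size (F m))]; split => //.
    by apply: finite_image; exact: finite_II.
  move=> hs [shs Khs]; have [x xF hx] := (FP m).2 hs shs Khs.
  exists (pickle (m, index x (F m))); first by exists (index x (F m)); rewrite //= index_mem.
  move=> [h hhs]; rewrite /hi /d pickleK nth_index// => le1.
  by have := hx h hhs; rewrite ltNge le1.
(* Let [h1] be high where [a i > 0] and low elsewhere, and [h2] the reverse: [h1 - h2] gains at
   least half of each [|a i|], while both are bounded by [m%:R * p m]. The successor keeps the
   constant positive for [m = 0]. *)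
- left; apply: (@ell1_embedding R E p (d \o g) gp hE _ m (4 * m.+1%:R)^-1).
  + by move=> k; have [M MP] := Dbnd k; exists M => n; exact: (MP _ (dD _)).
  + by rewrite invr_gt0 mulr_gt0.
  + move=> N a; set S := \sum_(0 <= i < N) _ *: _.
    have [h1 [lh1 Kh1] b1] := sh N (fun i => 0 < a i).
    have [h2 [lh2 Kh2] b2] := sh N (fun i => ~~ (0 < a i)).
    have hsum h : (forall a x y, h (a *: x + y) = a * h x + h y) ->
        h S = \sum_(0 <= i < N) a i * h (d (g i)).
      move=> lh; have h0 : h 0 = 0.
        by have := lh 1 0 0; rewrite scaler0 addr0 mul1r; lra.
      rewrite /S; elim: (N) => [|n IH]; first by rewrite !big_geq.
      by rewrite !big_nat_recr//= [X in h X]addrC lh IH addrC.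
    have : 2^-1 * \sum_(0 <= i < N) `|a i| <= h1 S - h2 S.
      rewrite (hsum _ lh1) (hsum _ lh2) -sumrB mulr_sumr !big_mkord.
      apply: ler_sum => i _; have := b1 i (ltn_ord i); have := b2 i (ltn_ord i).
      rewrite /hi /lo; case: ltP => ai /= le1 le2.
        by rewrite gtr0_norm//; nra.
      by rewrite ler0_norm//; nra.
    have := le_trans (ler_norm _) (Kh1 S).
    have := Kh2 S; rewrite ler_norml => /andP[+ _].
    have := seminorm_ge0 (gen_seminorm gp m) S.
    rewrite ler_pdivrMl ?mulr_gt0// -(natr1 m).
    set x := \sum_(0 <= i < N) _; set z := p m S; set y := m%:R.
    by move=> *; rewrite ler_pdivrMl ?mulr_gt0 ?ltr_wpDl ?ler0n//; nra.
(* That [hi] eventually fails for the multiples of [h] by 1/e and -1/e bounds [|h|] by [e]. *)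
- right; exists (d \o s) => [n|m h Kh]; first exact: dD.
  apply/cvgrPdist_lt => e e0.
  have [m1 K1] := polarZ e^-1 Kh; have [m2 K2] := polarZ (- e^-1) Kh.
  have [n1 N1] := sP _ _ K1; have [n2 N2] := sP _ _ K2.
  exists (maxn n1 n2) => // n; rewrite /= geq_max => /andP[/N1 + /N2].
  rewrite /hi => /negP + /negP; rewrite -!ltNge sub0r normrN mulNr.
  rewrite !(mulrC e^-1) -mulNr !ltr_pdivrMr// mul1r => ? ?.
  by rewrite ltr_norml; apply/andP; split => //; lra.
Qed.
End WeakNull.

(** * Frechet-Urysohn spaces are Ascoli *)

Section Convergence.
Context {R : realType}.

Lemma cvg_sum (T I : Type) (r : seq I) (F : set_system T) (f : I -> T -> R) (a : I -> R) :
  Filter F -> (forall i, f i x @[x --> F] --> a i) ->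
  \sum_(i <- r) f i x @[x --> F] --> \sum_(i <- r) a i.
Proof.
move=> FF fa; elim: r => [|i r IH].
  by under eq_fun do rewrite big_nil; rewrite big_nil; exact: cvg_cst.
under eq_fun do rewrite big_cons; rewrite big_cons.
by apply: cvgD IH; exact: fa.
Qed.

Lemma sum_continuous (T : topologicalType) (I : Type) (r : seq I) (f : I -> T -> R) :
  (forall i, continuous (f i)) -> continuous (fun x => \sum_(i <- r) f i x).
Proof. by move=> cf x; apply: cvg_sum => i; exact: cf. Qed.

Lemma initial_cvgP (S : choiceType) (T : topologicalType) (f : S -> T)
    (F : set_system S) (s : S) : Filter F ->
  (F --> (s : initial_topology f)) <-> (f x @[x --> F] --> f s).
Proof.
move=> FF; split=> Fs.
  by apply: (cvg_comp _ _ Fs); exact: (@initial_continuous S T f s).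
move=> U [_ [[V oV <-]] Vs VU]; apply: filterS VU _; apply: Fs.
exact: open_nbhs_nbhs.
Qed.

Lemma set_type_cvgP (T : topologicalType) (A : set T) (F : set_system A) (s : A) :
  Filter F -> (F --> s) <-> (set_val x @[x --> F] --> set_val s).
Proof. exact: initial_cvgP. Qed.

Lemma weak_cvgP (E : tvsType R) (F : set_system E) (x : E) : Filter F ->
  (F --> (x : weak_space E)) <-> forall f : dual E, sval f y @[y --> F] --> sval f x.
Proof.
move=> FF; split=> [/cvg_sup Fx f|Fx]; first by apply/initial_cvgP; exact: Fx.
by apply/cvg_sup => f; apply/initial_cvgP; exact: Fx.
Qed.

Lemma C_k_cvgP (Z : topologicalType) (F : set_system (C_k R Z)) (f : C_k R Z) :
  Filter F -> (F --> f) <-> forall (S : set Z) (O : set R), compact S -> open O ->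
    (f : continuousType Z R) @` S `<=` O ->
    F [set g : C_k R Z | (g : continuousType Z R) @` S `<=` O].
Proof.
move=> FF; split=> [Ff S O cS oO fSO|Ff].
  by move: Ff => /initial_cvgP/compact_open_cvgP; apply.
by apply/initial_cvgP/compact_open_cvgP.
Qed.

End Convergence.

Section FrechetUrysohn.
Context {R : realType} {Z : topologicalType}.

(** A filter on this set clusters at [z] or contains a set of finitely many terms. *)
Lemma compact_cvg_seq (y : nat -> Z) z :
  y @ \oo --> z -> compact ([set z] `|` range y).
Proof.
move=> yz F FF FS; have [cz|/existsNP[A /existsNP[B]]] := pselect (cluster F z).
  by exists z; split => //; left.
move=> /not_implyP[FA /not_implyP[zB AB]].
have [N _ NB] := yz B zB.
have [||x [[n _ <-] cx]] := @finite_compact _ (y @` `I_N) _ F FF.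
- by apply: finite_image; exact: finite_II.
- apply: filterS2 FA FS => x Ax [xz|[n _ yn]].
    by case: AB; exists x; split => //; rewrite xz; exact: nbhs_singleton.
  exists n => //=; rewrite ltnNge; apply/negP => /NB By; case: AB.
  by exists x; split => //; rewrite -yn.
by exists (y n); split => //; right; exists n.
Qed.

Definition frechet_urysohn := forall (z : Z) (D : set Z), closure D z ->
  exists2 y : nat -> Z, (forall n, D (y n)) & y @ \oo --> z.

(** Otherwise some [y n] tend to [z] while functions [g n] of [K] vary by [e] between [y n] and [z].
    A cluster point [h] of the [g n] is nearly constant on the compact set of [z] and a tail of [y],
    and some [g n] is close to it there. *)
Lemma frechet_urysohn_equicontinuous (K : set (C_k R Z)) (z : Z) (e : R) :
  frechet_urysohn -> compact K -> 0 < e ->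
  \forall y \near z, forall g : C_k R Z, K g ->
    `|(g : continuousType Z R) y - (g : continuousType Z R) z| < e.
Proof.
move=> FU cK e0; apply: contrapT => nnear.
pose D := [set y : Z | exists2 g : C_k R Z, K g &
  e <= `|(g : continuousType Z R) y - (g : continuousType Z R) z|].
have clD : closure D z.
  move=> W zW; apply: contrapT => DW; apply: nnear; apply: filterS zW => y Wy g Kg.
  rewrite ltNge; apply/negP => eg; apply: DW; exists y; split => //.
  by exists g.
have [y Dy yz] := FU z D clD.
have /choice[g gP] : forall n, exists g : C_k R Z, K g /\
    e <= `|(g : continuousType Z R) (y n) - (g : continuousType Z R) z|.
  by move=> n; have [g Kg eg] := Dy n; exists g.
have [|h [Kh ch]] := cK (g @ \oo) _.
  suff : \forall n \near \oo, K (g n) by [].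
  by apply: nearW => n; exact: (gP n).1.
pose O := ball ((h : continuousType Z R) z) (e / 2) : set R.
have e2 : 0 < e / 2 by rewrite divr_gt0.
have [N _ NO] : \forall n \near \oo, O ((h : continuousType Z R) (y n)).
  have /= := cvg_comp _ _ yz (@cts_fun _ _ (h : continuousType Z R) z).
  by apply; exact: nbhsx_ballx.
have cS : compact ([set z] `|` range (fun n => y (n + N)%N)).
  by apply: compact_cvg_seq; apply: cvg_comp yz; exact: cvg_addnr.
have nhW : nbhs h [set k : C_k R Z |
    (k : continuousType Z R) @` ([set z] `|` range (fun n => y (n + N)%N)) `<=` O].
  have /C_k_cvgP : nbhs h --> h by exact: cvg_id.
  apply => //; first exact: ball_open.
  move=> _ [x [->|[n _ <-]] <-]; first exact: ballxx.
  by apply: NO; rewrite /= leq_addl.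
have [_ [[n Nn <-] gO]] := ch (g @` [set n | (N <= n)%N]) _
  ltac:(by exists N => // n /= Nn; exists n) nhW.
have Oz : O ((g n : continuousType Z R) z) by apply: gO; exists z => //; left.
have Oy : O ((g n : continuousType Z R) (y n)).
  by apply: gO; exists (y n) => //; right; exists (n - N)%N; rewrite ?subnK.
have [_] := gP n; apply/negP; rewrite -ltNge.
move: Oz Oy; rewrite /O -ball_normE /= => Oz Oy.
rewrite (le_lt_trans (ler_distD ((h : continuousType Z R) z) _ _))//.
by rewrite distrC (splitr e) ltrD.
Qed.

Lemma frechet_urysohn_evenly_continuous (K : set (C_k R Z)) :
  frechet_urysohn -> compact K -> evenly_continuous K.
Proof.
move=> FU cK [z f]; apply/cvgrPdist_lt => e e0 /=.
have e2 : 0 < e / 2 by rewrite divr_gt0.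
have eq := frechet_urysohn_equicontinuous z FU cK e2.
pose O := ball ((set_val f : continuousType Z R) z) (e / 2) : set R.
have nf : \forall g \near f, O ((set_val g : continuousType Z R) z).
  have cz : compact [set z] by exact: compact_set1.
  have oO : open O by exact: ball_open.
  have /C_k_cvgP valf := @initial_continuous K (C_k R Z) set_val f.
  have : set_val g @[g --> f] [set h : C_k R Z | (h : continuousType Z R) @` [set z] `<=` O].
    apply: (valf _ _ O cz oO) => [|_ [_ -> <-]]; last exact: ballxx.
    exact/fmap_filter/(@nbhs_filter K).
  apply: (@filterS K (nbhs f) (@nbhs_filter K f)) => g gO.
  by apply: (gO ((set_val g : continuousType Z R) z)); exists z.
pose A := [set y | forall g : C_k R Z, K g ->
  `|(g : continuousType Z R) y - (g : continuousType Z R) z| < e / 2].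
pose B := [set g : K | O ((set_val g : continuousType Z R) z)].
have AB : nbhs ((z, f) : Z * K) (A `*` B).
  by exists (A, B); [split; [exact: eq|exact: nf]|].
apply: filterS AB => -[y g] /= [yP]; rewrite /B /O -ball_normE /= => gO.
rewrite (le_lt_trans (ler_distD ((set_val g : continuousType Z R) z) _ _))//.
rewrite (splitr e) ltrD// distrC; apply: yP.
exact: set_valP.
Qed.

End FrechetUrysohn.

(** * The weak topology on subsets *)

Section WeakSpace.
Context {R : realType} {E : tvsType R}.
Variables (p : nat -> E -> R).
Hypotheses (gp : generating p) (hE : frechet E).

Lemma polar_dual m h : polar p m h -> exists f : dual E, (sval f : E -> R) = h.
Proof.
by move=> /(polar_lin gp)[g <- cg]; exists (exist _ g cg).
Qed.

Lemma dual_polar (f : dual E) : exists m, polar p m (sval f : E -> R).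
Proof. by case: f => g cg; exact: continuous_polar. Qed.

Variable A : set E.
Local Notation Z := (set_type (A : set (weak_space E))).

Lemma weak_subtype_cvgP (F : set_system Z) (z : Z) : Filter F ->
  (F --> z) <-> forall f : dual E, sval f (set_val y) @[y --> F] --> sval f (set_val z).
Proof.
move=> FF; split=> [/set_type_cvgP /weak_cvgP|Fz]; first exact.
by apply/set_type_cvgP/weak_cvgP.
Qed.

Lemma weak_subtype_continuous (f : dual E) :
  continuous (fun y : Z => sval f (set_val y) : R).
Proof.
move=> z; have /weak_subtype_cvgP : nbhs z --> z by exact: cvg_id.
by move=> /(_ f).
Qed.

Definition weak_dist (fs : seq (dual E)) (z y : Z) : R :=
  \sum_(f <- fs) `|sval f (set_val y) - sval f (set_val z)|.

Lemma weak_dist_continuous fs z : continuous (weak_dist fs z).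
Proof.
apply: sum_continuous => f y.
exact: (cvg_norm (cvgB (@weak_subtype_continuous f y) (cvg_cst _))).
Qed.

(** The filter generated by the [weak_dist] balls converges to [z] by the criterion on functionals,
    hence contains every neighbourhood of [z]. *)
Lemma weak_subtype_nbhs (z : Z) (W : set Z) : nbhs z W ->
  exists fs e, 0 < e /\ [set y | weak_dist fs z y < e] `<=` W.
Proof.
pose Phi : set_system Z := [set W | exists fs e, 0 < e /\ [set y | weak_dist fs z y < e] `<=` W].
have PhiF : Filter Phi.
  split; first by exists [::], 1; split.
  - move=> P Q [fs [e [e0 P1]]] [gs [d [d0 Q1]]].
    exists (fs ++ gs), (Num.min e d); split; first by rewrite lt_min e0.
    move=> y /=; rewrite /weak_dist big_cat/= lt_min => /andP[ye yd].
    have fy : 0 <= weak_dist fs z y by apply: sumr_ge0.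
    have gy : 0 <= weak_dist gs z y by apply: sumr_ge0.
    split; [apply: P1|apply: Q1] => /=; rewrite -!/(weak_dist _ _ _) in ye yd *; lra.
  - by move=> P Q PQ [fs [e [e0 P1]]]; exists fs, e; split => //; exact: subset_trans PQ.
suff : Phi --> z by apply.
apply/weak_subtype_cvgP => f; apply/cvgrPdist_lt => e e0.
exists [:: f], e; split => // y /=.
by rewrite /weak_dist big_seq1 distrC.
Qed.

Lemma weak_subtype_tychonoff : tychonoff_space Z.
Proof.
split.
  move=> x y cxy; apply: val_inj; apply/eqP; rewrite -subr_eq0; apply/negPn/negP => xy.
  have [mE _] := hE; have [m [h [Kh hxy]]] := polar_separates gp mE xy.
  have [f fh] := polar_dual Kh.
  have : sval f (set_val x) = sval f (set_val y).
    apply: (@norm_hausdorff R R^o) => U V Ux Vy.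
    have [w [Uw Vw]] := cxy _ _ (weak_subtype_continuous Ux) (weak_subtype_continuous Vy).
    by exists (sval f (set_val w)).
  move/eqP; rewrite -subr_eq0 -linearB; move: hxy; rewrite -fh => hxy /eqP f0.
  by move: hxy; rewrite f0 ler10.
move=> z B clB nBz.
have [fs [e [e0 eB]]] : exists fs e, 0 < e /\ [set y | weak_dist fs z y < e] `<=` ~` B.
  by apply: weak_subtype_nbhs; apply: open_nbhs_nbhs; split => //; exact: closed_openC.
apply/(@uniform_separatorP _ R); exists (fun y => Num.min 1 (weak_dist fs z y / e)); split.
- move=> y; apply: (@continuous_min _ _ (cst 1) (fun y => weak_dist fs z y / e)).
    exact: cst_continuous.
  apply: (@continuousM _ _ (weak_dist fs z) (cst e^-1)); last exact: cst_continuous.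
  exact: (@weak_dist_continuous fs z y).
- move=> _ [y _ <-] /=; rewrite in_itv /= le_min ler01 /= ge_min lexx /= divr_ge0//.
    by apply: sumr_ge0.
  exact: ltW.
- move=> _ [_ -> <-] /=; rewrite /weak_dist big1 ?mul0r ?min_r// => f _.
  by rewrite subrr normr0.
- move=> _ [y By <-] /=; rewrite min_l// ler_pdivlMr// mul1r leNgt.
  by apply/negP => /eB.
Qed.

(** The dichotomy is applied to [D] translated by [z], which is bounded with [A]. *)
Lemma weak_subtype_frechet_urysohn : tvs_bounded A ->
  ~ (exists L : set E, isomorphic_copy (ell1 R) L) -> @frechet_urysohn Z.
Proof.
move=> bA nl1 z D clD; have [Dz|nDz] := pselect (D z).
  by exists (fun=> z) => //; exact: cvg_cst.
pose D' := [set set_val y - set_val z | y in D] : set E.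
have [||k hs Khs||[y D'y yP]] := @ell1_or_weak_null R E p gp hE D'.
- move=> k; have [M MP] := (gen_bounded gp A).1 bA k.
  exists (M + M) => _ [y _ <-].
  apply: le_trans (seminormB (gen_seminorm gp k) _ _) _.
  by apply: lerD; [exact: (MP _ (set_valP y))|exact: (MP _ (set_valP z))].
- move=> [y Dy /eqP]; rewrite subr_eq0 => /eqP yz; apply: nDz.
  by rewrite -(val_inj yz).
- have nW : nbhs z [set y : Z | forall h, h \in hs -> h (set_val y - set_val z) < 1].
    elim: hs Khs => [|h hs IH] Khs; first by apply: filterS filterT.
    have [|f fh] := @polar_dual k h; first exact: Khs (mem_head _ _).
    have : nbhs z [set y : Z | sval f (set_val y - set_val z) < 1].
      have /cvgr_lt := @weak_subtype_continuous f z.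
      move=> /(_ (sval f (set_val z) + 1)); rewrite ltrDl ltr01 => /(_ isT).
      by apply: filterS => y /=; rewrite linearB /= ltrBlDl.
    have /IH : forall h, h \in hs -> polar p k h.
      by move=> g ghs; apply: (Khs g); rewrite inE ghs orbT.
    apply: filterS2 => y yhs fy g; rewrite inE => /orP[/eqP ->|/yhs//].
    by rewrite -fh.
  have [y [Dy yhs]] := clD _ nW.
  by exists (set_val y - set_val z) => //; exists y.
- by [].
have /choice[u uP] : forall n, exists u : Z, D u /\ y n = set_val u - set_val z.
  by move=> n; have [u Du uy] := D'y n; exists u.
exists u => [n|]; first by have [] := uP n.
apply/weak_subtype_cvgP => f; have [m Km] := dual_polar f.
suff : sval f (set_val (u n)) @[n --> \oo] --> (sval f (set_val z) : R) by [].
have -> : (fun n => sval f (set_val (u n)) : R) =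
    (fun n => sval f (y n) + sval f (set_val z)).
  by apply/funext => n; have [_ ->] := uP n; rewrite linearB /= subrK.
rewrite -[X in _ --> X]add0r; apply: cvgD; first exact: yP Km.
exact: cvg_cst.
Qed.

Lemma weak_subtype_ascoli : tvs_bounded A ->
  ~ (exists L : set E, isomorphic_copy (ell1 R) L) -> ascoli_space R Z.
Proof.
move=> bA nl1; split; first exact: weak_subtype_tychonoff.
move=> K cK; apply: frechet_urysohn_evenly_continuous => //.
exact: weak_subtype_frechet_urysohn.
Qed.

End WeakSpace.

(** * The unit ball of a copy of l1 *)

Section Ell1Pairing.
Context {R : realType}.

Local Notation psum u n := (\sum_(0 <= i < n) `|u i|).

Lemma psum_unit_le1 (n N : nat) : psum (fun i => (i == n)%:R : R) N <= 1.
Proof.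
rewrite (eq_bigr (fun i => (i == n)%:R)); last by move=> i _; rewrite ger0_norm.
rewrite big_mkord; have [nN|Nn] := ltnP n N; last first.
  by rewrite big1// => i _; rewrite ltn_eqF// (leq_trans _ Nn).
rewrite (bigD1 (Ordinal nN))//= eqxx big1 ?addr0// => i /negPf.
by rewrite -val_eqE /= => ->.
Qed.

Lemma ell1_unit_subproof n : (fun i => (i == n)%:R : R) \in ell1_pred.
Proof. by apply: (@ell1_pred_bounded _ _ 1) => N; exact: psum_unit_le1. Qed.

Definition ell1_unit n : ell1 R := Ell1 (ell1_unit_subproof n).

Lemma ell1_norm_unit n : `|ell1_unit n| <= 1 :> R.
Proof. by apply: ell1_norm_le => N; exact: psum_unit_le1. Qed.

Lemma ell1_coord_le (u : ell1 R) n : `|u n| <= `|u|.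
Proof.
apply: le_trans (ell1_psum_le u n.+1); rewrite big_nat_recr//= lerDr.
exact: sumr_ge0.
Qed.

Section Pairing.
Variable v : nat -> R.
Hypothesis v1 : forall n, `|v n| <= 1.

Definition pairing (u : ell1 R) : R := limn (series (fun i => v i * u i)).

Let pairing_cvg (u : ell1 R) : cvgn (series (fun i => v i * u i)).
Proof.
apply: normed_cvg; apply: (series_le_cvg _ _ _ (@ell1_cvg R u)) => n /=.
- exact: normr_ge0.
- exact: normr_ge0.
- by rewrite normrM ler_piMl.
Qed.

Lemma pairing_linear : linear_for *:%R (pairing : ell1 R -> R^o).
Proof.
move=> a x y; apply: cvg_lim => //.
have -> : series (fun i => v i * (a *: x + y : ell1 R) i) =
    (fun n => a * series (fun i => v i * x i) n + series (fun i => v i * y i) n).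
  apply/funext => n; rewrite /series /= mulr_sumr -big_split; apply: eq_bigr => i _ /=.
  by rewrite mulrDr mulrCA.
by apply: cvgD; [apply: cvgMr|]; exact: pairing_cvg.
Qed.

Lemma pairing_tail (u : ell1 R) N :
  `|pairing u - \sum_(0 <= i < N) v i * u i| <= `|u| - psum u N.
Proof.
have cv : `|series (fun i => v i * u i) n - \sum_(0 <= i < N) v i * u i| @[n --> \oo]
    --> `|pairing u - \sum_(0 <= i < N) v i * u i|.
  by apply: cvg_norm; apply: cvgB; [exact: pairing_cvg|exact: cvg_cst].
apply: (cvgr_to_le cv); exists N => // n /= Nn; rewrite /series /=.
rewrite (big_cat_nat (leq0n N) Nn)//= addrAC subrr add0r lerBrDr.
apply: le_trans (ell1_psum_le u n); rewrite (big_cat_nat (leq0n N) Nn)//=.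
rewrite [leRHS]addrC lerD2r; apply: le_trans (ler_norm_sum _ _ _) _.
by apply: ler_sum => i _; rewrite normrM ler_piMl.
Qed.

Lemma pairing_le (u : ell1 R) : `|pairing u| <= `|u|.
Proof. by have := pairing_tail u 0; rewrite !big_geq// !subr0. Qed.

End Pairing.
End Ell1Pairing.

(** * The image of the unit ball is closed, convex and bounded *)

Section Converse.
Context {R : realType} {E : tvsType R}.
Variables (p : nat -> E -> R).
Hypotheses (gp : generating p) (hE : frechet E).

Local Notation psum u n := (\sum_(0 <= i < n) `|u i|).

(** Continuity of both maps at 0, rescaled by homogeneity. *)
Lemma copy_bounds (L : set E) : isomorphic_copy (ell1 R) L ->
  exists f : {linear ell1 R -> E},
    (forall k, exists M, forall u, p k (f u) <= M * `|u|) /\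
    exists k C, 0 < C /\ forall u, `|u| <= C * p k (f u).
Proof.
move=> [_ [f [g [fL fK gK cf cg]]]]; exists f; split=> [k|].
  have : nbhs (0 : E) [set x | p k x < 1].
    by apply/(gen_nbhsP gp); exists k, 1; split => // x /=; rewrite subr0.
  have := cf 0; rewrite /continuous_at linear0 => /[apply].
  move=> /(@nbhs_ballP R (ell1 R))[e /= e0 eP].
  exists (2 / e) => u; have [->|u0] := eqVneq u 0.
    by rewrite linear0 (seminorm0 (gen_seminorm gp k)) normr0 mulr0.
  have nu : 0 < `|u| by rewrite normr_gt0.
  have t0 : 0 < e / 2 / `|u| by rewrite !divr_gt0.
  have := eP ((e / 2 / `|u|) *: u); rewrite -ball_normE /= sub0r normrN normrZ.
  rewrite gtr0_norm// divfK ?gt_eqF// gtr_pMr// invf_lt1// ltr1n => /(_ isT).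
  rewrite linearZ /= (seminormZ (gen_seminorm gp k)) gtr0_norm//.
  rewrite -ltr_pdivlMl// mulr1 => /ltW /le_trans; apply.
  suff -> : (e / 2 / `|u|)^-1 = 2 / e * `|u| by [].
  by field; rewrite !gt_eqF.
have L0 : L 0 by rewrite -(linear0 f); exact: fL.
have /subspace_continuousP/(_ 0 L0) := cg; rewrite /from_subspace.
have g0 : g 0 = 0 by rewrite -(linear0 f) fK.
rewrite g0 => /(_ (ball (0 : ell1 R) 1)) => /(_ (nbhsx_ballx _ _ ltr01)).
move=> /(gen_nbhsP gp)[k [e [e0 eP]]].
exists k, (2 / e); split=> [|u]; first exact: divr_gt0.
rewrite leNgt; apply/negP => lt_u.
have nu : 0 < `|u|.
  apply: le_lt_trans lt_u; apply: mulr_ge0; last exact: seminorm_ge0 (gen_seminorm gp k) _.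
  by rewrite divr_ge0// ltW.
have iu : 0 < `|u|^-1 by rewrite invr_gt0.
have := eP (f (`|u|^-1 *: u)).
rewrite /= subr0 linearZ /= (seminormZ (gen_seminorm gp k)) gtr0_norm//.
rewrite ltr_pdivrMl// => lt_e.
have lt1 : p k (f u) < `|u| * e.
  have pk0 := seminorm_ge0 (gen_seminorm gp k) (f u).
  move: lt_u; rewrite -mulrA mulrCA ltr_pdivrMl// (mulrC e) => ?; lra.
have := lt_e lt1; rewrite /preimage /= -linearZ => /(_ (fL _ I)).
rewrite fK -ball_normE /= sub0r normrN normrZ gtr0_norm//.
by rewrite mulVf ?ltxx// gt_eqF.
Qed.

Variables (f : {linear ell1 R -> E}) (k : nat) (C : R).
Hypothesis f_up : forall j, exists M, forall u, p j (f u) <= M * `|u|.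
Hypothesis C0 : 0 < C.
Hypothesis f_low : forall u, `|u| <= C * p k (f u).

(** [f_low] lets Hahn-Banach carry functionals of norm at most 1 from l1 to [E], with a bound
    uniform in [phi]. *)
Lemma ell1_dual_extension (phi : {linear ell1 R -> R^o}) :
  (forall u, `|phi u| <= `|u|) -> exists h : dual E,
    (forall u, sval h (f u) = phi u) /\ forall x, `|sval h x| <= C * p k x.
Proof.
move=> phi1; pose q x := C * p k x.
have sq : seminorm q.
  split=> [y z|a y]; rewrite /q; last by rewrite (seminormZ (gen_seminorm gp k)) mulrCA.
  by rewrite -mulrDr ler_pM2l// seminormD//; exact: gen_seminorm.
have [h [hf hq]] := hahn_banach sq (f := f) (phi := phi)
  (fun u => le_trans (phi1 u) (f_low u)).
have ch : continuous (h : E -> R^o).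
  by apply/(gen_linear_continuous gp); exists k, C.
by exists (exist _ h ch).
Qed.

Lemma coord_dual_ex n : exists h : dual E,
  (forall u, sval h (f u) = u n) /\ forall x, `|sval h x| <= C * p k x.
Proof.
have lin : linear_for *:%R ((fun u : ell1 R => u n) : ell1 R -> R^o) by [].
pose phi : {linear ell1 R -> R^o} := HB.pack ((fun u : ell1 R => u n) : ell1 R -> R^o)
  (GRing.isLinear.Build R (ell1 R) R^o *:%R _ lin).
by apply: (ell1_dual_extension (phi := phi)) => u; exact: ell1_coord_le.
Qed.

Definition coord n : dual E := sval (cid (coord_dual_ex n)).

Lemma coordE n u : sval (coord n) (f u) = u n.
Proof. exact: (svalP (cid (coord_dual_ex n))).1. Qed.

Lemma coord_le n x : `|sval (coord n) x| <= C * p k x.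
Proof. exact: (svalP (cid (coord_dual_ex n))).2. Qed.

Lemma pairing_dual_ex v : (forall n : nat, `|v n| <= 1) ->
  exists h : dual E, forall u, sval h (f u) = pairing v u.
Proof.
move=> v1.
pose phi : {linear ell1 R -> R^o} := HB.pack (pairing v : ell1 R -> R^o)
  (GRing.isLinear.Build R (ell1 R) R^o *:%R _ (pairing_linear v1)).
have [|h [hf _]] := ell1_dual_extension (phi := phi).
  by move=> u; exact: pairing_le.
by exists h.
Qed.

Let A : set E := [set f u | u in [set u | `|u| <= 1]].

Lemma image_ball_convex : convex_set A.
Proof.
move=> _ _ l /set_mem[u /= u1 <-] /set_mem[w /= w1 <-]; rewrite inE.
exists (l%:num *: u + (1 - l%:num) *: w); last by rewrite linearD !linearZ.
rewrite /= (le_trans (ler_normD _ _))// !normrZ.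
have l0 : 0 <= l%:num by []. have l1 : l%:num <= 1 by [].
rewrite !ger0_norm ?subr_ge0//; have l1' : 0 <= 1 - l%:num by rewrite subr_ge0.
by nra.
Qed.

Lemma image_ball_bounded : tvs_bounded A.
Proof.
apply/(gen_bounded gp) => j; have [M MP] := f_up j; exists `|M| => _ [u /= u1 <-].
apply: le_trans (MP u) _; have := ler_norm M; have := normr_ge0 u.
by have := normr_ge0 M; nra.
Qed.

(** The extended coordinate functionals read off the preimage [u] of a limit point [y]; its partial
    sums are at most 1, and [b] is near [u] when [f b] is near [y]. *)
Lemma image_ball_closed : closed A.
Proof.
move=> y clA.
have near j d : 0 < d -> exists b, [/\ `|b| <= 1, p j (f b - y) < d & p k (f b - y) < d].
  move=> d0; have : nbhs y [set x | p (maxn j k) (x - y) < d].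
    by apply/(gen_nbhsP gp); exists (maxn j k), d; split.
  move=> /clA[_ [[b /= b1 <-] /= bd]]; exists b; split=> //.
    by apply: le_lt_trans bd; apply: gen_le => //; exact: leq_maxl.
  by apply: le_lt_trans bd; apply: gen_le => //; exact: leq_maxr.
pose c n : R := sval (coord n) y.
have coord_diff n (b : ell1 R) : `|b n - c n| <= C * p k (f b - y).
  by rewrite /c -coordE -linearB; exact: coord_le.
have sum_diff N (b : ell1 R) : \sum_(0 <= i < N) `|b i - c i| <= N%:R * (C * p k (f b - y)).
  apply: (@le_trans _ _ (\sum_(0 <= i < N) (C * p k (f b - y)))).
    by apply: ler_sum => i _.
  by rewrite sumr_const_nat subn0 mulr_natl.
have small N e : 0 < e -> exists2 d, 0 < d & N%:R * (C * d) <= e.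
  move=> e0; have NC : 0 < N%:R * C + 1 by rewrite ltr_wpDl ?mulr_ge0// ltW.
  exists (e / (N%:R * C + 1)); first exact: divr_gt0.
  rewrite mulrA mulrCA ger_pMr// ler_pdivrMr// mul1r lerDl.
  exact: ler01.
have c1 N : psum c N <= 1.
  apply/ler_addgt0Pr => e e0; have [d d0 dN] := small N e e0.
  have [b [b1 _ bd]] := near k d d0.
  have : psum c N <= psum b N + \sum_(0 <= i < N) `|b i - c i|.
    rewrite -big_split /=; apply: ler_sum => i _.
    by rewrite -[in leLHS](subKr (b i) (c i)) ler_normB.
  have := sum_diff N b; have := ell1_psum_le b N; rewrite -ell1_normE.
  have : N%:R * (C * p k (f b - y)) <= N%:R * (C * d).
    by rewrite ler_wpM2l// ler_pM2l// ltW.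
  by lra.
pose u := Ell1 (ell1_pred_bounded c1).
exists u; first exact: ell1_norm_le.
(* As [f u = y] is not yet known, [f_low] is applied to [b - b'] for a second [f b'] near [y], whose
   first [N] coordinates approximate those of [u]. *)
have dist_le (b : ell1 R) d : p k (f b - y) < d -> `|b - u| <= C * d.
  move=> bd; have C1 : 0 < 1 / C by rewrite divr_gt0.
  apply: ell1_norm_le => N; apply/ler_addgt0Pr => e e0.
  have e2 : 0 < e / 2 by rewrite divr_gt0.
  have [d1 d10 d1N] := small N _ e2; have [d2 d20 d2N] := small 1%N _ e2.
  have dd : 0 < Num.min d1 d2 by rewrite lt_min d10.
  have [b' [b'1 _ b'd]] := near k _ dd.
  move: b'd; rewrite lt_min => /andP[b'd1 b'd2].
  have h1 : \sum_(0 <= i < N) `|(b - u : ell1 R) i| <=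
      psum (b - b' : ell1 R) N + \sum_(0 <= i < N) `|b' i - c i|.
    rewrite -big_split /=; apply: ler_sum => i _.
    exact: ler_distD.
  have h2 := ell1_psum_le (b - b') N; have h3 := f_low (b - b').
  rewrite ell1_normE linearB in h3.
  have h4 : p k (f b - f b') <= p k (f b - y) + p k (f b' - y).
    have := seminormB (gen_seminorm gp k) (f b - y) (f b' - y).
    by rewrite opprB addrA subrK.
  have h5 := sum_diff N b'.
  have h6 : N%:R * (C * p k (f b' - y)) <= N%:R * (C * d1).
    by rewrite ler_wpM2l// ler_pM2l// ltW.
  rewrite mul1r in d2N.
  have h7 : C * p k (f b - f b') <= C * (p k (f b - y) + p k (f b' - y)).
    by rewrite ler_pM2l.
  have h8 : C * p k (f b' - y) <= C * d2 by rewrite ler_pM2l// ltW.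
  have h9 : C * p k (f b - y) <= C * d by rewrite ler_pM2l// ltW.
  by lra.
have [mE _] := hE; apply/eqP; rewrite -subr_eq0; apply/eqP/(gen_eq0 gp mE) => j.
apply/eqP; rewrite eq_le seminorm_ge0 ?andbT; last exact: gen_seminorm.
apply/ler_addgt0Pr => e e0; rewrite add0r.
have [M MP] := f_up j.
have M1 : 0 < `|M| * C + 1 by rewrite ltr_wpDl// mulr_ge0// ltW.
have [b [_ bj bk]] := near j _ (divr_gt0 e0 M1).
set d := e / _ in bj bk.
have h1 : p j (f u - y) <= p j (f b - y) + p j (f (b - u)).
  rewrite linearB; have := seminormB (gen_seminorm gp j) (f b - y) (f b - f u).
  by rewrite opprB addrC addrA subrK.
have h2 : p j (f (b - u)) <= `|M| * (C * d).
  apply: le_trans (MP _) _; apply: (@le_trans _ _ (`|M| * `|b - u|)).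
    by rewrite ler_wpM2r// ler_norm.
  by rewrite ler_wpM2l// dist_le.
have h3 : d * (`|M| * C + 1) = e by rewrite /d divfK// gt_eqF.
by lra.
Qed.

End Converse.

(** * Failure of even continuity on the unit ball of l1 *)

Section NotAscoli.
Context {R : realType} {E : tvsType R}.
Variables (A : set E) (f : {linear ell1 R -> E}) (phi : nat -> dual E).
Hypothesis A_def : forall x, A x <-> exists2 u, `|u| <= 1 & f u = x.
Hypothesis phiE : forall n u, sval (phi n) (f u) = u n.
Hypothesis pair_ex : forall v, (forall n : nat, `|v n| <= 1) ->
  exists h : dual E, forall u, sval h (f u) = pairing v u.

Local Notation Z := (set_type (A : set (weak_space E))).
Local Notation psum u n := (\sum_(0 <= i < n) `|u i|).

Let rep_ex (z : Z) : exists u : ell1 R, `|u| <= 1 /\ f u = set_val z.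
Proof.
by have /A_def[u u1 uz] : A (set_val z) := set_valP z; exists u.
Qed.

Let rep z := sval (cid (rep_ex z)).

Let repE z : f (rep z) = set_val z. Proof. exact: (svalP (cid (rep_ex z))).2. Qed.

Let rep_coord z n : rep z n = sval (phi n) (set_val z).
Proof. by rewrite -repE phiE. Qed.

Let coord_near (z : Z) N (d : R) : 0 < d ->
  \forall y \near z, \sum_(0 <= i < N) `|rep y i - rep z i| < d.
Proof.
move=> d0; pose F i (y : Z) : R := `|sval (phi i) (set_val y) - sval (phi i) (set_val z)|.
have cF i : continuous (F i).
  move=> y; have h := @weak_subtype_continuous R E A (phi i) y.
  exact: (cvg_norm (cvgB h (cvg_cst _))).
have /cvgr_lt /(_ d) := sum_continuous (r := index_iota 0 N) cF (x := z).
rewrite [X in X < d]big1 => [/(_ d0)|i _]; last by rewrite /F subrr normr0.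
by apply: filterS => y; rewrite /F; under eq_bigr do rewrite -!rep_coord.
Qed.

(* A gliding hump argument: large coordinates along infinitely many indices
   produce a functional separating a subsequence from its cluster point. *)
Lemma compact_coord_small (S : set Z) : compact S ->
  exists N, forall n z, (N <= n)%N -> S z -> `|sval (phi n) (set_val z)| <= 4^-1.
Proof.
move=> cS; apply: contrapT => nN.
have /choice[nz nzP] : forall N, exists nz : nat * Z,
    [/\ (N <= nz.1)%N, S nz.2 & 4^-1 < `|rep nz.2 nz.1|].
  move=> N; apply: contrapT => nnz; apply: nN; exists N => n z Nn Sz.
  rewrite leNgt -rep_coord; apply/negP => lt; apply: nnz.
  by exists (n, z).
pose n m := (nz m).1; pose z m := (nz m).2.
have nge m : (m <= n m)%N by have [] := nzP m.
have Sz m : S (z m) by have [] := nzP m.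
have hump m : 4^-1 < `|rep (z m) (n m)| by have [] := nzP m.
have [|a [Sa ca]] := cS (z @ \oo) _.
  suff : \forall m \near \oo, S (z m) by [].
  by apply: nearW.
(* The hump 1/4 loses three errors [eta], one head and two tails: 1/4 - 3/24 = 1/8. *)
pose c := rep a; pose eta : R := 24^-1; have eta0 : 0 < eta by rewrite invr_gt0.
have step N (d : R) : 0 < d ->
    exists m, (N <= m)%N /\ \sum_(0 <= i < N) `|rep (z m) i - c i| < d.
  move=> d0; have [_ [[m Nm <-] zm]] := ca (z @` [set m | (N <= m)%N]) _
    ltac:(by exists N => // m /= Nm; exists m) (coord_near a N d0).
  by exists m.
(* Up to the cut [N] the new term agrees with [a], with an error tending to 0 in [j]; the next cut
   comes after its hump and nearly all of its norm. *)
have next j N : {mN : nat * nat | [/\ (N <= mN.1)%N,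
    \sum_(0 <= i < N) `|rep (z mN.1) i - c i| < eta / j.+1%:R, (n mN.1 < mN.2)%N &
    `|rep (z mN.1)| - psum (rep (z mN.1)) mN.2 < eta]}.
  apply: cid; have ej : 0 < eta / j.+1%:R by rewrite divr_gt0.
  have [m [Nm dm]] := step N _ ej.
  have [M MP] := ell1_psum_gt (rep (z m)) eta0.
  exists (m, maxn M (n m).+1); split => //=; first by rewrite leq_maxr.
  by have := MP _ (leq_maxl M (n m).+1); rewrite ltrBlDr -ltrBlDl addrC.
have [N0 N0P] := ell1_psum_gt c eta0.
pose NN := fix NN j := if j is j'.+1 then (sval (next j' (NN j'))).2 else N0.
pose m j := (sval (next j (NN j))).1; pose w j := rep (z (m j)).
have mP j : [/\ (NN j <= m j)%N,
    \sum_(0 <= i < NN j) `|w j i - c i| < eta / j.+1%:R, (n (m j) < NN j.+1)%N &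
    `|w j| - psum (w j) (NN j.+1) < eta] by exact: (svalP (next j (NN j))).
have NN_lt j : (NN j < NN j.+1)%N.
  by have [h _ h' _] := mP j; exact: leq_ltn_trans (leq_trans h (nge _)) h'.
have NN_le i j : (i <= j)%N -> (NN i <= NN j)%N.
  by move=> /subnK <-; elim: (j - i)%N => // k IH; exact: leq_trans IH (ltnW (NN_lt _)).
have NN_ge j : (j <= NN j)%N.
  by elim: j => // j IH; exact: leq_ltn_trans IH (NN_lt j).
(* [v] carries the signs of [w j] on the j-th block; indices before the first cut get 0. *)
have /choice[v vP] : forall i, exists r : R, `|r| <= 1 /\
    forall j, (NN j <= i < NN j.+1)%N -> r * w j i = `|w j i|.
  move=> i; have [[j ji]|nj] := pselect (exists j, (NN j <= i < NN j.+1)%N); last first.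
    by exists 0; split=> [|j ji]; [rewrite normr0|case: nj; exists j].
  exists (if 0 <= w j i then 1 else -1); split.
    by case: ifP => _; rewrite ?normrN normr1.
  move=> j' j'i; suff -> : j' = j.
    by case: ifPn => [/ger0_norm ->|]; rewrite ?mul1r// -ltNge => /ltr0_norm ->;
      rewrite mulN1r.
  apply/eqP; rewrite eqn_leq; apply/andP; split; rewrite leqNgt; apply/negP => lt.
    have := NN_le _ _ lt; move: ji j'i => /andP[_ h1] /andP[h2 _].
    by rewrite leqNgt (leq_ltn_trans h2 h1).
  have := NN_le _ _ lt; move: ji j'i => /andP[h1 _] /andP[_ h2].
  by rewrite leqNgt (leq_ltn_trans h1 h2).
have [h hE] := pair_ex (fun i => (vP i).1).
have sep j : 8^-1 <= sval h (set_val (z (m j))) - sval h (set_val a).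
  rewrite -!repE !hE -/(w j) -/c.
  have [N_le dj n_lt tl] := mP j.
  have t1 := le_lt_trans (pairing_tail (fun i => (vP i).1) (w j) (NN j.+1)) tl.
  have t2 := le_lt_trans (pairing_tail (fun i => (vP i).1) c (NN j))
    (_ : `|c| - psum c (NN j) < eta).
  have /t2 {}t2 : `|c| - psum c (NN j) < eta.
    by have := N0P _ (NN_le 0%N j (leq0n j)); rewrite ltrBlDr -ltrBlDl addrC.
  have t3 : `|\sum_(0 <= i < NN j) (v i * w j i - v i * c i)| <= eta.
    apply: le_trans (ler_norm_sum _ _ _) _; apply: (@le_trans _ _ (eta / j.+1%:R)).
      apply: le_trans (ltW dj); apply: ler_sum => i _.
      by rewrite -mulrBr normrM ler_piMl// (vP i).1.
    by rewrite ler_pdivrMr// ler_peMr ?ler1n// ltW.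
  have t4 : 4^-1 <= \sum_(NN j <= i < NN j.+1) v i * w j i.
    rewrite (eq_big_nat _ _ (F2 := fun i => `|w j i|)); last first.
      by move=> i ij; exact: (vP i).2.
    apply: (le_trans (ltW (hump (m j)))).
    rewrite (big_cat_nat (leq_trans N_le (nge _)) (ltnW n_lt))/=.
    by rewrite [X in _ + X]big_ltn//= addrCA lerDl addr_ge0// sumr_ge0.
  move: t1 t2 t3; rewrite sumrB (big_cat_nat (leq0n _) (ltnW (NN_lt j)))/=.
  rewrite !ltr_norml !ler_norml => /andP[t1 _] /andP[_ t2] /andP[t3 _].
  rewrite /eta in t1 t2 t3; lra.
have [|b [Sb cb]] := cS (z \o m @ \oo) _.
  suff : \forall j \near \oo, S (z (m j)) by [].
  by apply: nearW.
have cbj J (W : set Z) : nbhs b W -> exists2 j, (J <= j)%N & W (z (m j)).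
  move=> bW; have [_ [[j Jj <-] Wj]] := cb ((z \o m) @` [set j | (J <= j)%N]) _
    ltac:(by exists J => // j /= Jj; exists j) bW.
  by exists j.
(* The coordinates of [w j] tend to those of [a], which identifies the cluster point [b] with [a],
   although [h] keeps the subsequence 1/8 away. *)
have ba : rep b = c.
  apply/val_inj/funext => i /=; apply/eqP; rewrite -subr_eq0 -normr_le0.
  apply/ler_addgt0Pr => e e0; rewrite add0r.
  have e2 : 0 < e / 2 by rewrite divr_gt0.
  pose J := maxn i.+1 (Num.truncn (eta / (e / 2))).+1.
  have [j Jj bj] := cbj J _ (coord_near b i.+1 e2).
  have [_ dj _ _] := mP j.
  have j_gt : eta / j.+1%:R < e / 2.
    rewrite ltr_pdivrMr// mulrC -ltr_pdivrMr//; apply: lt_trans (truncnS_gt _) _.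
    rewrite ltr_nat ltnS; apply: leq_trans Jj; exact: leq_maxr.
  have h1 : `|w j i - rep b i| < e / 2.
    apply: le_lt_trans bj; rewrite big_nat_recr//= lerDr sumr_ge0//.
  have h2 : `|w j i - c i| < e / 2.
    apply: lt_trans j_gt; apply: le_lt_trans dj.
    have iN : (i < NN j)%N.
      by apply: leq_trans (NN_ge j); apply: leq_trans Jj; exact: leq_maxl.
    rewrite (big_cat_nat (leq0n i.+1) iN)/= big_nat_recr//= -addrA [leRHS]addrCA.
    by rewrite lerDl addr_ge0// sumr_ge0.
  rewrite distrC in h1; have := ler_distD (w j i) (rep b i) (c i); lra.
have [j _] := cbj 0%N _ (cvgr_lt _ (@weak_subtype_continuous _ _ _ h b)
  (sval h (set_val b) + 8^-1) ltac:(by rewrite ltrDl invr_gt0)).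
have -> : set_val b = set_val a by rewrite -!repE ba.
by rewrite /= -ltrBlDl; apply/negP; rewrite -leNgt.
Qed.

Hypothesis f_unit_bounded : forall h : dual E, exists M : R,
  forall n, `|sval h (f (ell1_unit n))| <= M.

Let bump n (y : Z) : R := Num.max 0 (`|sval (phi n) (set_val y)| - 4^-1).

Let bump_continuous n : continuous (bump n).
Proof.
move=> y; pose g (y : Z) : R := `|sval (phi n) (set_val y)| - 4^-1.
apply: (@continuous_max _ _ (cst 0) g y (@cst_continuous Z R 0 y)).
exact: (cvgB (cvg_norm (@weak_subtype_continuous _ _ _ (phi n) y)) (cvg_cst _)).
Qed.

Let unit_diff m n : ell1 R := 2^-1 *: (ell1_unit m - ell1_unit n).

Let A_unit_diff m n : A (f (unit_diff m n)).
Proof.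
apply/A_def; exists (unit_diff m n) => //; rewrite normrZ ger0_norm//.
have := ler_normB (@ell1_unit R m) (ell1_unit n).
by have := @ell1_norm_unit R m; have := @ell1_norm_unit R n; lra.
Qed.

(** Along a free ultrafilter each functional converges on the [ell1_unit n], so two distinct
    indices, one of them beyond [N], give nearly equal values for all of [fs]. *)
Let unit_diff_near (z : Z) (W : set Z) N : set_val z = 0 -> nbhs z W ->
  exists m n, [/\ (N <= n)%N, m != n &
    W (exist _ (f (unit_diff m n)) (mem_set (A_unit_diff m n)))].
Proof.
move=> z0 /weak_subtype_nbhs[fs [e [e0 eW]]].
have [U [UU UN]] := ultraFilterLemma (_ : ProperFilter (\oo : set_system nat)).
have /choice[l lP] : forall h : dual E, exists l : R,
    sval h (f (ell1_unit n)) @[n --> U] --> l.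
  move=> h; have [M MP] := f_unit_bounded h.
  exact: (ultra_bounded_cvg (v := fun n => sval h (f (ell1_unit n)) : R) UU MP).
have Ue : U [set n | \sum_(h <- fs) `|sval h (f (ell1_unit n)) - l h| < e].
  have : \sum_(h <- fs) `|sval h (f (ell1_unit n)) - l h| @[n --> U] -->
      \sum_(h <- fs) `|l h - l h|.
    by apply: cvg_sum => h; apply: (cvg_norm (cvgB (lP h) (cvg_cst _))).
  move=> /cvgr_lt; apply; rewrite big1// => h _.
  by rewrite subrr normr0.
have tail k : U [set n | (k <= n)%N] by apply: UN; exists k.
have [m [me _]] := filter_ex (filterI Ue (tail 0%N)).
have [n [ne nN]] := filter_ex (filterI Ue (tail (maxn N m.+1))).
move: nN; rewrite /= geq_max => /andP[Nn mn].
exists m, n; split => //; first by rewrite ltn_eqF.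
apply: eW; rewrite /= /weak_dist z0.
have h_le (h : dual E) : `|sval h (f (unit_diff m n)) - sval h 0| <=
    2^-1 * `|sval h (f (ell1_unit m)) - l h| + 2^-1 * `|sval h (f (ell1_unit n)) - l h|.
  rewrite linear0 subr0 /unit_diff linearZ linearB linearZ linearB /=.
  rewrite normrZ ger0_norm// -mulrDr ler_wpM2l//.
  by rewrite [X in _ <= _ + X]distrC; exact: ler_distD.
apply: (@le_lt_trans _ _ (2^-1 * (\sum_(h <- fs) `|sval h (f (ell1_unit m)) - l h|) +
    2^-1 * (\sum_(h <- fs) `|sval h (f (ell1_unit n)) - l h|))).
  by rewrite !mulr_sumr -big_split; apply: ler_sum => h _.
by move: me ne => /=; lra.
Qed.

Theorem ell1_ball_not_ascoli : ~ ascoli_space R Z.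
Proof.
move=> [_ ev].
have A0 : A 0 by apply/A_def; exists 0; rewrite ?normr0 ?linear0.
pose z0 : Z := exist _ 0 (mem_set A0).
pose F n : C_k R Z := mkcts (@bump_continuous n).
have c0 : continuous (fun _ : Z => 0 : R) by exact: cst_continuous.
pose F0 : C_k R Z := mkcts c0.
have FF0 : F @ \oo --> F0.
  apply/C_k_cvgP => S O cS oO SO; have [N NP] := compact_coord_small cS.
  exists N => // n Nn _ [x Sx <-].
  have -> : (F n : continuousType Z R) x = 0.
    by rewrite /F /= /mkcts /bump max_l// subr_le0; exact: NP.
  by apply: SO; exists x.
have cK := compact_cvg_seq FF0.
set K := [set F0] `|` range F in cK.
have KF n : K (F n) by right; exists n.
have KF0 : K F0 by left.
pose k n : K := exist _ (F n) (mem_set (KF n)).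
pose k0 : K := exist _ F0 (mem_set KF0).
have kk0 : k @ \oo --> k0 by apply/set_type_cvgP.
have q0 : 0 < 4^-1 :> R by rewrite invr_gt0.
(* The tolerance 1/4 equals [bump n] at [unit_diff m n], namely 1/2 - 1/4, which the strict
   inequality forbids. *)
have /cvgr_dist_lt /(_ _ q0) := ev K cK (z0, k0).
move=> [[P Q] /= [zP kQ] PQ].
have [N _ NQ] := kk0 Q kQ.
have [m [n [Nn mn aP]]] := @unit_diff_near z0 P N erefl zP.
have := PQ (exist _ (f (unit_diff m n)) (mem_set (A_unit_diff m n)), k n)
  (conj aP (NQ n Nn)).
have phi_n : sval (phi n) (f (unit_diff m n)) = - 2^-1.
  rewrite phiE; have -> : unit_diff m n n = 2^-1 * ((n == m)%:R - (n == n)%:R) by [].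
  by rewrite eqxx [n == m]eq_sym (negPf mn) sub0r mulrN1.
have bump_n : bump n (exist _ (f (unit_diff m n)) (mem_set (A_unit_diff m n))) = 4^-1.
  have -> : bump n (exist _ (f (unit_diff m n)) (mem_set (A_unit_diff m n))) =
    Num.max 0 (`|sval (phi n) (f (unit_diff m n))| - 4^-1) by [].
  by rewrite phi_n normrN ger0_norm ?invr_ge0// max_r; lra.
rewrite /= -[X in `|_ - X|]/(bump n _) bump_n sub0r normrN ger0_norm ?invr_ge0//.
by rewrite ltxx.
Qed.
End NotAscoli.

Theorem theorem1p10 (R : realType) (E : tvsType R) (hE : frechet E) :
  ~ (exists L : set E, isomorphic_copy (ell1 R) L) <->
  (forall A : set E, closed A -> convex_set A -> tvs_bounded A ->
     ascoli_space R (set_type (A : set (weak_space E)))).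
Proof.
have [p gp] := frechet_seminorms hE.
split=> [nl1 A _ _ bA|ascoliE [L copyL]].
  exact: (weak_subtype_ascoli gp hE bA nl1).
have [f [f_up [k [C [C0 f_low]]]]] := copy_bounds gp copyL.
apply: (@ell1_ball_not_ascoli R E [set f u | u in [set u | `|u| <= 1]] f
  (coord gp C0 f_low)).
- by [].
- exact: coordE.
- exact: (pairing_dual_ex gp C0 f_low).
- move=> h; have [m [_ hm]] := dual_polar gp h; have [M MP] := f_up m.
  exists (m%:R * `|M|) => n; apply: le_trans (hm _) _; apply: ler_wpM2l => //.
  apply: le_trans (MP _) _; apply: le_trans (ler_wpM2r _ (ler_norm M)) _ => //.
  by rewrite ler_piMr// ell1_norm_unit.
- apply: ascoliE.
  + exact: (image_ball_closed gp hE f_up C0 f_low).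
  + exact: image_ball_convex.
  + exact: (image_ball_bounded gp f_up).
Qed.
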